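(* For all $\lambda>0$, $\overline{\mathrm{Range}(R^\ast_\lambda)}=\overline{\mathrm{Ker}(B)\cap H^1}$, where the bars denote closure in $H$.
   Context: Setting. $(M,g)$ is a compact oriented $d$-dimensional Riemannian manifold without boundary, $U\in C^1(M)$ is such that $\pi(dx)=e^{-U(x)}\mathrm{vol}(dx)$ is a probability measure, $\langle f,h\rangle=\int_M fh\,d\pi$, and $v\cdot w$ denotes the Riemannian inner product of tangent vectors. $A$ is the Friedrichs extension in $L^2(M,\pi)$ of $f\mapsto\Delta f-\nabla U\cdot\nabla f$ on $C^\infty(M)$ ($\Delta$ has spectrum in $(-\infty,0]$). It is assumed that $A$ has discrete spectrum $0=\lambda_0>-\lambda_1\ge-\lambda_2\ge\dots$ with $\lambda_n\to\infty$ and a complete orthonormal basis of eigenvectors $\phi_0,\phi_1,\dots$ of $L^2(M,\pi)$, $A\phi_n=-\lambda_n\phi_n$, with $\phi_0$ spanning the constants. Sobolev spaces: $H^m=\{\varphi=\sum_{k\ge1}a_k\phi_k:\ \sum_{k\ge1}|a_k|^2\lambda_k^m<\infty\}$ and $H:=H^0$ (the orthogonal complement of the constants in $L^2(M,\pi)$, with the $L^2$ norm). On $H^1$: $\langle f,h\rangle_{H^1}=\int_M\nabla f\cdot\nabla h\,d\pi$. $b$ is a $C^1$ vector field on $M$ with $\mathrm{div}(e^{-U}b)=0$ and $H^1\subset\mathrm{Dom}(b\cdot\nabla)$. $B:H^1\to H$ is the continuous extension of $f\mapsto b\cdot\nabla f$ from smooth functions; it is antisymmetric. $\mathrm{Ker}(B)\cap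 H^1=\{\varphi\in H^1:B\varphi=0\}$. $R^\ast_\lambda g:=-P_{1,\lambda}(A-\lambda)^{-1}g$ for $g\in H$, $\lambda>0$, where $P_{1,\lambda}$ is the orthogonal projection of $H^1$ onto $\mathrm{Ker}(B)\cap H^1$ with respect to $\langle\psi,\varphi\rangle_{1,\lambda}=\langle\psi,\varphi\rangle_{H^1}+\lambda\langle\psi,\varphi\rangle$. *)

(* Defs.v *)
From HB Require Import structures.
From mathcomp Require Import all_boot all_order all_algebra.
From mathcomp Require Import all_classical all_reals all_analysis.

Set Implicit Arguments.
Unset Strict Implicit.
Unset Printing Implicit Defensive.

Import Order.TTheory GRing.Theory Num.Theory.
Import numFieldNormedType.Exports.

Local Open Scope classical_set_scope.
Local Open Scope ring_scope.

(* Elements of L^2(mu) are represented by square integrable functions; equality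
   in L^2 is equality mu-almost everywhere.  All the sets of functions defined
   from these notions are saturated for that equality. *)
Section L2.
Context {d : measure_display} {T : measurableType d} {R : realType}.
Variable mu : {measure set T -> \bar R}.
Implicit Types (f g h : T -> R) (D : set (T -> R)).

Definition L2 : set (T -> R) := [set f | f \in Lfun mu 2%:E].

Definition L2eq f g : Prop := {ae mu, forall x, f x = g x}.

Definition L2ip f g : R := (\int[mu]_x (f x * g x))%R.

Definition L2norm f : R := Num.sqrt (L2ip f f).

Definition L2cvg (u : nat -> T -> R) f : Prop :=
  (fun n => L2norm (u n \- f)) @ \oo --> (0 : R).

(* Partial sums of a family indexed from 1: \sum_(1 <= k <= n) a_k phi_k. *)
Definition psum1 (a : nat -> R) (phi : nat -> T -> R) (n : nat) : T -> R :=
  fun x => \sum_(1 <= k < n.+1) a k * phi k x.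

(* An unbounded operator on L^2 is given by its graph. *)
Definition operator := (T -> R) -> (T -> R) -> Prop.

Definition form_cauchy (q : (T -> R) -> (T -> R) -> R) (u : nat -> T -> R) :=
  forall e : R, 0 < e ->
  exists N, forall m n, (N <= m)%N -> (N <= n)%N ->
    q (u m \- u n) (u m \- u n) < e.

(* Domain of the closure of a nonnegative form q with domain D. *)
Definition form_closure_dom D (q : (T -> R) -> (T -> R) -> R) : set (T -> R) :=
  [set f | L2 f /\ exists u : nat -> T -> R,
    [/\ forall n, D (u n), L2cvg u f & form_cauchy q u]].

(* Extension by continuity of q to the domain of its closure. *)
Definition form_closure D (q : (T -> R) -> (T -> R) -> R) f h : R :=
  xget 0 [set c | exists u v : nat -> T -> R,
    [/\ (forall n, D (u n)) /\ (forall n, D (v n)),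
        L2cvg u f /\ L2cvg v h,
        form_cauchy q u /\ form_cauchy q v &
        (fun n => q (u n) (v n)) @ \oo --> c]].

(* A is the Friedrichs extension of the nonpositive symmetric operator
   S : D -> L^2(mu): it extends S, and it is the restriction of the adjoint S^*
   to the domain of the closure of the form (f, h) |-> - <S f, h>. *)
Definition friedrichs_extension D (S : (T -> R) -> T -> R) (A : operator) :=
  (forall f, D f -> A f (S f)) /\
  (forall f g, A f g <->
    [/\ L2 f, L2 g,
        form_closure_dom D (fun u v => - L2ip (S u) v) f &
        forall h, D h -> L2ip f (S h) = L2ip g h]).

(* Domain of the closure in L^2 x L^2 of S : D -> L^2(mu). *)
Definition closure_dom D (S : (T -> R) -> T -> R) : set (T -> R) :=
  [set f | L2 f /\ exists2 g, L2 g &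
    exists u : nat -> T -> R,
      [/\ forall n, D (u n), L2cvg u f & L2cvg (fun n => S (u n)) g]].

(* A has the eigenvalues 0 = -ev_0 > -ev_1 >= -ev_2 >= ..., tending to -oo, and
   phi is a complete orthonormal basis of eigenvectors. *)
Record discrete_spectrum (A : operator) (ev : nat -> R) (phi : nat -> T -> R) :
    Prop := DiscreteSpectrum {
  ev_0 : ev 0%N = 0 ;
  ev_1 : 0 < ev 1%N ;
  ev_nondecreasing : forall m n, (m <= n)%N -> ev m <= ev n ;
  ev_cvg : ev @ \oo --> +oo ;
  phi_L2 : forall n, L2 (phi n) ;
  phi_eigen : forall n, A (phi n) (fun x => - ev n * phi n x) ;
  phi_orthonormal : forall m n, L2ip (phi m) (phi n) = (m == n)%:R ;
  phi_complete : forall f, L2 f ->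
    L2cvg (fun n x => \sum_(k < n) L2ip f (phi k) * phi k x) f ;
  phi_0 : exists c : R, L2eq (phi 0%N) (cst c) }.

Definition sobolev (ev : nat -> R) (phi : nat -> T -> R) (m : nat) :
    set (T -> R) :=
  [set f | L2 f /\ exists a : nat -> R,
    cvgn (fun n => \sum_(1 <= k < n.+1) `|a k| ^+ 2 * ev k ^+ m) /\
    L2cvg (psum1 a phi) f].

Definition closure_in (H S : set (T -> R)) : set (T -> R) :=
  [set f | H f /\ forall e : R, 0 < e ->
    exists2 s, S s & L2norm (f \- s) < e].

(* p is the orthogonal projection of w on K inside V, for the inner product q *)
Definition is_proj (V K : set (T -> R)) (q : (T -> R) -> (T -> R) -> R) w p :=
  [/\ V w, K p & forall k, K k -> q (w \- p) k = 0].

(* B is a bounded linear operator from V, with inner product q, to H, and it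
   coincides with S on D `&` V. *)
Definition continuous_extension D (S : (T -> R) -> T -> R)
    (V H : set (T -> R)) (q : (T -> R) -> (T -> R) -> R)
    (B : (T -> R) -> T -> R) :=
  [/\ forall f, V f -> H (B f),
      forall (a : R) f g, V f -> V g ->
        L2eq (B (fun x => a * f x + g x)) (fun x => a * B f x + B g x),
      exists C : R, forall f, V f -> L2norm (B f) <= C * Num.sqrt (q f f) &
      forall f, D f -> V f -> L2eq (B f) (S f)].

Definition ker_in (V : set (T -> R)) (B : (T -> R) -> T -> R) : set (T -> R) :=
  [set f | V f /\ L2eq (B f) (cst 0)].

(* Graph of g |-> - P (A - lambda)^-1 g on H, where P is the q-orthogonal
   projection of V on K; the witness w is (A - lambda)^-1 g.  Single-valued up to a.e. equality. *)
Definition neg_proj_resolvent (A : operator) (lambda : R)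
    (V K : set (T -> R)) (q : (T -> R) -> (T -> R) -> R) : operator :=
  fun g u => exists w p : T -> R,
    [/\ A w (fun x => lambda * w x + g x), is_proj V K q w p &
        L2eq u (fun x => - p x)].

Definition range_on (H : set (T -> R)) (Op : operator) : set (T -> R) :=
  [set u | L2 u /\ exists2 g, H g & Op g u].

End L2.

Section Ck.
Context {R : realType} {d : nat}.
Implicit Types (O : set 'rV[R]_d) (F : 'rV[R]_d -> R).

Definition partial (i : 'I_d) F : 'rV[R]_d -> R := 'D_(delta_mx ord0 i) F.

(* Meaningful for O open. *)
Fixpoint Ck (k : nat) O F : Prop :=
  (forall x, O x -> {for x, continuous F}) /\
  (if k is k'.+1 then
     forall i : 'I_d,
       (forall x, O x -> derivable F x (delta_mx ord0 i)) /\
       Ck k' O (partial i F)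
   else True).

Definition Cinfty O F : Prop := forall k, Ck k O F.

End Ck.

(* Integral over R^d of a nonnegative Borel function, as an iterated Lebesgue
   integral (Tonelli). *)
Fixpoint iterated_integral {R : realType} (d : nat) :
    ('rV[R]_d -> \bar R) -> \bar R :=
  match d return ('rV[R]_d -> \bar R) -> \bar R with
  | 0%N => fun F => F 0
  | d'.+1 => fun F =>
      (\int[@lebesgue_measure R]_t
         iterated_integral
           (fun y : 'rV[R]_d' => F (row_mx (const_mx t : 'rV[R]_1) y)))%E
  end.

(* [cinv] is only meaningful on the open set [cmap @` cdom]. *)
Record chart (R : realType) (d : nat) (M : topologicalType) := Chart {
  cdom : set M ;
  cmap : M -> 'rV[R]_d ;
  cinv : 'rV[R]_d -> M ;
  cdom_open : open cdom ;
  cimg_open : open (cmap @` cdom) ;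
  cmapK : forall p, cdom p -> cinv (cmap p) = p ;
  cmap_continuous : forall p, cdom p -> {for p, continuous cmap} ;
  cinv_continuous : forall x, (cmap @` cdom) x -> {for x, continuous cinv} }.

Section Transition.
Context {R : realType} {d : nat} {M : topologicalType}.
Implicit Types c : chart R d M.

Definition cimg c : set 'rV[R]_d := cmap c @` cdom c.

Definition overlap c c' : set 'rV[R]_d := cmap c @` (cdom c `&` cdom c').

Definition transition c c' : 'rV[R]_d -> 'rV[R]_d := cmap c' \o cinv c.

(* Tangent vectors are row vectors, so that components v in the chart c become
   v *m jac c c' x in the chart c'. *)
Definition jac c c' (x : 'rV[R]_d) : 'M[R]_d :=
  \matrix_(i, j) partial i (fun y => transition c c' y ord0 j) x.

End Transition.

(* Smooth d-dimensional manifold without boundary, with an oriented atlas. *)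
Record oriented_manifold (R : realType) (d : nat) (M : topologicalType) :=
  OrientedManifold {
  atlas : set (chart R d M) ;
  chart_at : M -> chart R d M ;
  chart_at_atlas : forall p, atlas (chart_at p) ;
  chart_at_dom : forall p, cdom (chart_at p) p ;
  manifold_hausdorff : hausdorff_space M ;
  manifold_second_countable : @second_countable M ;
  transition_smooth : forall c c', atlas c -> atlas c' ->
    forall j : 'I_d,
      Cinfty (overlap c c') (fun x => transition c c' x ord0 j) ;
  transition_oriented : forall c c', atlas c -> atlas c' ->
    forall x, overlap c c' x -> 0 < \det (jac c c' x) }.

(* The metric is given by its matrix in each chart. *)
Record riemannian_metric (R : realType) (d : nat) (M : topologicalType)
    (X : oriented_manifold R d M) := RiemannianMetric {
  gmat : chart R d M -> 'rV[R]_d -> 'M[R]_d ;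
  gmat_smooth : forall c, atlas X c ->
    forall i j : 'I_d, Cinfty (cimg c) (fun x => gmat c x i j) ;
  gmat_sym : forall c, atlas X c ->
    forall x, cimg c x -> (gmat c x)^T = gmat c x ;
  gmat_pos : forall c, atlas X c -> forall x, cimg c x ->
    forall v : 'rV[R]_d, v != 0 -> 0 < (v *m gmat c x *m v^T) ord0 ord0 ;
  gmat_compat : forall c c', atlas X c -> atlas X c' ->
    forall x, overlap c c' x ->
      gmat c x =
      jac c c' x *m gmat c' (transition c c' x) *m (jac c c' x)^T }.

Section Geometry.
Context {R : realType} {d : nat} {M : ptopologicalType}.
Variables (X : oriented_manifold R d M) (g : riemannian_metric X).
Implicit Types f h U : M -> R.

Definition Ck_fun (k : nat) : set (M -> R) :=
  [set f : M -> R | forall c, atlas X c -> Ck k (cimg c) (f \o cinv c)].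

Definition smooth_fun : set (M -> R) := [set f : M -> R | forall k, Ck_fun k f].

(* Components of a vector field in every chart. *)
Definition vfield := chart R d M -> 'rV[R]_d -> 'rV[R]_d.
Implicit Types b v w : vfield.

Definition Ck_vfield (k : nat) : set vfield :=
  [set b : vfield |
    (forall c, atlas X c ->
      forall i : 'I_d, Ck k (cimg c) (fun x => b c x ord0 i)) /\
    (forall c c', atlas X c -> atlas X c' -> forall x, overlap c c' x ->
      b c' (transition c c' x) = b c x *m jac c c' x)].

Definition grad f : vfield := fun c x =>
  (\row_(i < d) partial i (f \o cinv c) x) *m invmx (gmat g c x).

(* vdot and divergence evaluate a coordinate expression at p in the chart
   chart_at p; by the transformation laws the chart does not matter. *)
Definition vdot v w : M -> R := fun p =>
  let c := chart_at X p in let x := cmap c p in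
  (v c x *m gmat g c x *m (w c x)^T) ord0 ord0.

Definition vol_density (c : chart R d M) (x : 'rV[R]_d) : R :=
  Num.sqrt (\det (gmat g c x)).

Definition divergence v : M -> R := fun p =>
  let c := chart_at X p in let x := cmap c p in
  (vol_density c x)^-1 *
  \sum_(i < d) partial i (fun y => vol_density c y * v c y ord0 i) x.

Definition laplacian f : M -> R := divergence (grad f).

Definition generator U f : M -> R := laplacian f \- vdot (grad U) (grad f).

Definition vscale f v : vfield := fun c x => f (cinv c x) *: v c x.

Definition advection b f : M -> R := vdot b (grad f).

Definition borel := g_sigma_algebraType (@open M).

Definition riemannian_volume (vol : {measure set borel -> \bar R}) : Prop :=
  forall c, atlas X c -> forall E : set borel, measurable E -> E `<=` cdom c ->
    vol E = iterated_integral
      (fun x => if x \in (cmap c @` E) then (vol_density c x)%:E else 0%E).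

Definition weighted_volume (vol : {measure set borel -> \bar R}) U
    (pi : {measure set borel -> \bar R}) : Prop :=
  forall E : set borel, measurable E ->
    pi E = (\int[vol]_(x in E) (expR (- U x))%:E)%E.

Definition dirichlet (pi : {measure set borel -> \bar R}) f h : R :=
  (\int[pi]_x vdot (grad f) (grad h) x)%R.

(* <f, h>_{H^1} = \int grad f . grad h dpi, the gradient being extended from
   smooth functions by L^2-continuity. *)
Definition H1ip (pi : {measure set borel -> \bar R}) : (M -> R) -> (M -> R) -> R :=
  form_closure pi smooth_fun (dirichlet pi).

Definition H1ip_lambda (pi : {measure set borel -> \bar R}) (lambda : R) f h : R :=
  H1ip pi f h + lambda * L2ip pi f h.

End Geometry.

(* Main.v *)
(* The range of R^*_lambda lies in Ker(B) by definition of the projection.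
   Conversely, given k in Ker(B), the eigenfunction expansion w_n of -k converges
   to -k in H^1 and w_n = (A - lambda)^-1 g_n with g_n a finite combination of
   eigenfunctions; the projection being a contraction fixing -k, the elements
   -P w_n of the range converge to k.  The projections exist because Ker(B) is
   complete for <., .>_{1,lambda}: L^2 is complete, the Dirichlet form is closed,
   and B is bounded.

   No integration by parts on the manifold is carried out: the Friedrichs
   hypothesis makes L = Delta - grad U . grad symmetric on smooth functions, so
   that the integral of L(fh) vanishes, and integrating the product rule
   L(fh) = f Lh + h Lf + 2 grad f . grad h shows that the Dirichlet form is
   -<f, Lh>. *)

Require Import Defs.
From HB Require Import structures.
From mathcomp Require Import all_boot all_order all_algebra.
From mathcomp Require Import all_classical all_reals all_analysis.
From mathcomp Require Import measurable_realfun ring lra.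

Set Implicit Arguments.
Unset Strict Implicit.
Unset Printing Implicit Defensive.

Import Order.TTheory GRing.Theory Num.Theory.
Import numFieldNormedType.Exports.

Local Open Scope classical_set_scope.
Local Open Scope ring_scope.

(** * Semi-inner products and orthogonal projection *)

Section SemiInner.
Context {R : realType} {E : lmodType R}.
Implicit Types (V K : set E) (q : E -> E -> R) (u v : nat -> E).

(** Elements of L^2 are functions rather than classes, so every form here is only semi-definite:
    limits are unique only up to null vectors, and the kernel of [B] must be shown stable under
    almost everywhere equality before the range can lie in it. Convergence is measured by the
    squared quantity [q x x], and Young's inequality with a free parameter plays the part of
    Cauchy-Schwarz.

    The geometry reaches the functional analysis through one identity on smooth functions,
    [q f h = - <f, S h>], together with positivity. That identity makes the form closable, hence
    [form_closure] well defined, and makes the form domain closed under limits that converge both in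
    L^2 and in energy. The bridge to the spectral definition is that H^1 is exactly the part of the
    form domain orthogonal to [phi 0]. Positivity of [lambda] is what brings estimates in the energy
    norm back to L^2, at the price of a factor [1 / lambda]. *)

Definition is_subspace V := V 0 /\ forall (a : R) x y, V x -> V y -> V (a *: x + y).

(** The axioms are relative to [V] because a closed form is meaningful only on its domain, and omit
    definiteness because functions equal almost everywhere remain distinct. *)
Record semi_inner V q : Prop := SemiInner {
  si_sub : is_subspace V ;
  si_sym : forall x y, V x -> V y -> q x y = q y x ;
  si_lin : forall (a : R) x y z, V x -> V y -> V z ->
    q (a *: x + y) z = a * q x z + q y z ;
  si_ge0 : forall x, V x -> 0 <= q x x }.

Definition qcauchy q u := forall e : R, 0 < e ->
  exists N, forall m n, (N <= m)%N -> (N <= n)%N ->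
    q (u m - u n) (u m - u n) < e.

Definition qcvg q u x := forall e : R, 0 < e ->
  exists N, forall n, (N <= n)%N -> q (u n - x) (u n - x) < e.

Lemma is_subspaceD V x y : is_subspace V -> V x -> V y -> V (x + y).
Proof. by move=> [_ sV] Vx Vy; rewrite -[x]scale1r; exact: sV. Qed.

Lemma is_subspaceZ V (a : R) x : is_subspace V -> V x -> V (a *: x).
Proof. by move=> [V0 sV] Vx; rewrite -[_ *: _]addr0; exact: sV. Qed.

Lemma is_subspaceN V x : is_subspace V -> V x -> V (- x).
Proof. by move=> sV Vx; rewrite -scaleN1r; exact: is_subspaceZ. Qed.

Lemma is_subspaceB V x y : is_subspace V -> V x -> V y -> V (x - y).
Proof. by move=> sV Vx Vy; apply: is_subspaceD => //; exact: is_subspaceN. Qed.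

Section Fixed.
Variables (V : set E) (q : E -> E -> R).
Hypothesis hq : semi_inner V q.
Let sV := si_sub hq.

Lemma qDl x y z : V x -> V y -> V z -> q (x + y) z = q x z + q y z.
Proof. by move=> ? ? ?; rewrite -[in LHS](scale1r x) (si_lin hq)// mul1r. Qed.

Lemma q0l z : V z -> q 0 z = 0.
Proof.
by move=> Vz; apply: (addIr (q 0 z)); rewrite -qDl ?addr0 ?add0r//; case: sV.
Qed.

Lemma qZl (a : R) x z : V x -> V z -> q (a *: x) z = a * q x z.
Proof.
move=> Vx Vz; rewrite -[_ *: _]addr0 (si_lin hq)//; first by rewrite q0l// addr0.
by case: sV.
Qed.

Lemma qNl x z : V x -> V z -> q (- x) z = - q x z.
Proof. by move=> ? ?; rewrite -scaleN1r qZl// mulN1r. Qed.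

Lemma qBl x y z : V x -> V y -> V z -> q (x - y) z = q x z - q y z.
Proof. by move=> ? ? ?; rewrite qDl ?qNl//; exact: is_subspaceN. Qed.

Lemma qDr x y z : V x -> V y -> V z -> q x (y + z) = q x y + q x z.
Proof.
move=> ? ? ?; rewrite (si_sym hq) ?qDl//; last exact: is_subspaceD.
by rewrite ![q _ x](si_sym hq).
Qed.

Lemma qZr (a : R) x z : V x -> V z -> q x (a *: z) = a * q x z.
Proof.
move=> ? ?; rewrite (si_sym hq) ?qZl//; last exact: is_subspaceZ.
by rewrite (si_sym hq).
Qed.

Lemma qNr x z : V x -> V z -> q x (- z) = - q x z.
Proof. by move=> ? ?; rewrite -scaleN1r qZr// mulN1r. Qed.

Lemma qBr x y z : V x -> V y -> V z -> q x (y - z) = q x y - q x z.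
Proof. by move=> ? ? ?; rewrite qDr ?qNr//; exact: is_subspaceN. Qed.

Lemma q_suml (I : Type) (r : seq I) (P : pred I) (F : I -> E) z :
  (forall i, P i -> V (F i)) -> V z ->
  V (\sum_(i <- r | P i) F i) /\
  q (\sum_(i <- r | P i) F i) z = \sum_(i <- r | P i) q (F i) z.
Proof.
move=> VF Vz.
elim/big_ind2 : _ => [|x a y b [Vx <-] [Vy <-]|i Pi]; last by split => //; exact: VF.
  by rewrite q0l//; split => //; case: sV.
by rewrite qDl//; split => //; exact: is_subspaceD.
Qed.

Lemma qsub_sym x y : V x -> V y -> q (x - y) (x - y) = q (y - x) (y - x).
Proof.
move=> Vx Vy; have ? := is_subspaceB sV Vx Vy.
by rewrite -[in RHS]opprB qNl ?qNr ?opprK//; exact: is_subspaceN.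
Qed.

Lemma q_expand (t : R) x y : V x -> V y ->
  q (t *: x + y) (t *: x + y) = t ^+ 2 * q x x + 2 * t * q x y + q y y.
Proof.
move=> Vx Vy; have ? := is_subspaceZ t sV Vx.
rewrite qDl ?qDr ?qZl ?qZr//; last exact: is_subspaceD.
by rewrite (si_sym hq Vy Vx); ring.
Qed.

Lemma q_addl2 x y : V x -> V y ->
  q (x + y) (x + y) <= 2 * q x x + 2 * q y y.
Proof.
move=> Vx Vy.
have := si_ge0 hq (is_subspaceD sV (is_subspaceZ (-1) sV Vx) Vy).
have := q_expand 1 Vx Vy; rewrite scale1r => ->; rewrite q_expand//; lra.
Qed.

Lemma q_trans x y z : V x -> V y -> V z ->
  q (x - z) (x - z) <= 2 * q (x - y) (x - y) + 2 * q (y - z) (y - z).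
Proof.
by move=> Vx Vy Vz; rewrite -[x - z](subrKA y) q_addl2//; exact: is_subspaceB.
Qed.

Lemma q_sub_proj x p : V x -> V p -> q p x = q p p ->
  q (x - p) (x - p) = q x x - q p p.
Proof.
move=> Vx Vp e; have Vd := is_subspaceB sV Vx Vp.
by rewrite qBl// !qBr// (si_sym hq Vx Vp) e subrr subr0.
Qed.

Lemma q_orthogonal_le x y : V x -> V y -> q x y = 0 ->
  q y y <= q (x + y) (x + y).
Proof.
move=> Vx Vy xy; have := q_expand 1 Vx Vy; rewrite scale1r xy => ->.
by rewrite mulr0 addr0 lerDr expr1n mul1r; exact: si_ge0 hq _ _.
Qed.

(** Expand [q] at [t^-1 x + y] and at [- t^-1 x + y], both nonnegative, and multiply by [t]. The
    bound is twice the sharp one. *)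
Lemma q_young (t : R) x y : 0 < t -> V x -> V y ->
  `|q x y| <= q x x / t + t * q y y.
Proof.
move=> t0 Vx Vy.
have h (s : R) : 0 <= s ^+ 2 * q x x + 2 * s * q x y + q y y.
  rewrite -q_expand//; apply: (si_ge0 hq).
  by apply: is_subspaceD => //; exact: is_subspaceZ.
have x0 := si_ge0 hq Vx.
have y0 := si_ge0 hq Vy.
have t0' : 0 < t^-1 by rewrite invr_gt0.
have h1 := mulr_ge0 (ltW t0) (h t^-1).
have h2 := mulr_ge0 (ltW t0) (h (- t^-1)).
have e1 : t * (t^-1 ^+ 2 * q x x + 2 * t^-1 * q x y + q y y) =
   q x x / t + 2 * q x y + t * q y y by field; rewrite gt_eqF.
have e2 : t * ((- t^-1) ^+ 2 * q x x + 2 * (- t^-1) * q x y + q y y) =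
   q x x / t - 2 * q x y + t * q y y by field; rewrite gt_eqF.
rewrite e1 in h1; rewrite e2 in h2.
have h3 : 0 <= q x x / t by rewrite mulr_ge0// ltW.
have h4 : 0 <= t * q y y by rewrite mulr_ge0// ltW.
by rewrite ler_norml; apply/andP; split; lra.
Qed.

(** Null vectors are orthogonal to everything: in [q_young] only the term [t * q y y] survives, and
    [t] is arbitrary. This is what makes [L2ip] insensitive to almost everywhere equality. *)
Lemma q_eq0 x y : V x -> V y -> q x x = 0 -> q x y = 0.
Proof.
move=> Vx Vy x0; apply/eqP; rewrite -normr_le0; apply/ler_addgt0Pl => e e0.
have y0 := si_ge0 hq Vy.
have y1 : 0 < q y y + 1 by rewrite ltr_wpDl.
apply: (le_trans (q_young (divr_gt0 e0 y1) Vx Vy)).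
rewrite x0 mul0r add0r addr0 mulrAC ler_pdivrMr//.
by rewrite ler_wpM2l ?ler_wpDr// ltW.
Qed.

Lemma qcvg_cauchy u x : (forall n, V (u n)) -> V x -> qcvg q u x -> qcauchy q u.
Proof.
move=> Vu Vx ux e e0.
have e4 : 0 < e / 4 by rewrite divr_gt0.
have [N uN] := ux _ e4; exists N => m n Nm Nn.
have := q_trans (Vu m) Vx (Vu n); have := uN _ Nm; have := uN _ Nn.
by rewrite (qsub_sym Vx)//; lra.
Qed.

Lemma qcauchy_lin (a : R) u v : (forall n, V (u n)) -> (forall n, V (v n)) ->
  qcauchy q u -> qcauchy q v -> qcauchy q (fun n => a *: u n + v n).
Proof.
move=> Vu Vv cu cv e e0.
have e1 : 0 < e / (4 * (a ^+ 2 + 1)).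
  by rewrite divr_gt0// mulr_gt0// ltr_wpDl// sqr_ge0.
have e4 : 0 < e / 4 by rewrite divr_gt0.
have [N1 u1] := cu _ e1; have [N2 v2] := cv _ e4.
exists (maxn N1 N2) => m n; rewrite !geq_max => /andP[m1 m2] /andP[n1 n2].
rewrite opprD addrACA -scalerBr.
have Vmn := is_subspaceB sV (Vu m) (Vu n).
apply: (le_lt_trans (q_addl2 _ _)); [exact: is_subspaceZ|exact: is_subspaceB|].
rewrite qZl ?qZr//; last exact: is_subspaceZ.
have := u1 _ _ m1 n1; rewrite ltr_pdivlMr; last by rewrite mulr_gt0// ltr_wpDl// sqr_ge0.
have := v2 _ _ m2 n2; have := si_ge0 hq Vmn; nra.
Qed.

Lemma qcvg_lin (a : R) u v x y : (forall n, V (u n)) -> (forall n, V (v n)) ->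
  V x -> V y ->
  qcvg q u x -> qcvg q v y -> qcvg q (fun n => a *: u n + v n) (a *: x + y).
Proof.
move=> Vu Vv Vx Vy cu cv e e0.
have e1 : 0 < e / (4 * (a ^+ 2 + 1)).
  by rewrite divr_gt0// mulr_gt0// ltr_wpDl// sqr_ge0.
have e4 : 0 < e / 4 by rewrite divr_gt0.
have [N1 u1] := cu _ e1; have [N2 v2] := cv _ e4.
exists (maxn N1 N2) => m; rewrite !geq_max => /andP[m1 m2].
rewrite opprD addrACA -scalerBr.
have Vmn := is_subspaceB sV (Vu m) Vx.
apply: (le_lt_trans (q_addl2 _ _)); [exact: is_subspaceZ|exact: is_subspaceB|].
rewrite qZl ?qZr//; last exact: is_subspaceZ.
have := u1 _ m1; rewrite ltr_pdivlMr; last by rewrite mulr_gt0// ltr_wpDl// sqr_ge0.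
have := v2 _ m2; have := si_ge0 hq Vmn; nra.
Qed.

Lemma qcauchy_bounded u : (forall n, V (u n)) -> qcauchy q u ->
  exists M N, 0 < M /\ forall n, (N <= n)%N -> q (u n) (u n) <= M.
Proof.
move=> Vu cu; have [N uN] := cu _ ltr01.
exists (2 + 2 * q (u N) (u N)), N; split.
  by rewrite ltr_wpDr// mulr_ge0//; exact: si_ge0 hq _ _.
move=> n Nn; have := uN _ _ Nn (leqnn N).
have := q_addl2 (is_subspaceB sV (Vu n) (Vu N)) (Vu N).
by rewrite subrK; lra.
Qed.

(* [x] and [y] are arbitrary, so that this gives both the Cauchy property of
   [q (u n) (v n)] and the independence of its limit from [u] and [v]. *)
Lemma q_pair_small u v : (forall n, V (u n)) -> (forall n, V (v n)) ->
  qcauchy q u -> qcauchy q v -> forall e : R, 0 < e ->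
  exists N (d : R), 0 < d /\ forall n x y, (N <= n)%N -> V x -> V y ->
    q (u n - x) (u n - x) < d -> q (v n - y) (v n - y) < d ->
    `|q (u n) (v n) - q x y| < e.
Proof.
move=> Vu Vv cu cv e e0.
have [M1 [N1 [M10 uM1]]] := qcauchy_bounded Vu cu.
have [M2 [N2 [M20 vM2]]] := qcauchy_bounded Vv cv.
pose M := M1 + M2 + 1.
have M0 : 0 < M by rewrite /M; lra.
(* With [t * M = e / 8] and [d / t <= e / 8], the two Young bounds below add up to at most 7e/8;
   [d <= 1] serves to bound [q y y] by [4 * M]. *)
pose t := e / (8 * M).
have t0 : 0 < t by rewrite /t divr_gt0// mulr_gt0.
pose d := Num.min 1 (e / 8 * t).
have d0 : 0 < d by rewrite /d lt_min ltr01 mulr_gt0// divr_gt0.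
exists (maxn N1 N2), d; split => // n x y; rewrite geq_max => /andP[n1 n2] Vx Vy ux vy.
have Vux := is_subspaceB sV (Vu n) Vx; have Vvy := is_subspaceB sV (Vv n) Vy.
have -> : q (u n) (v n) - q x y = q (u n - x) y + q (v n - y) (u n).
  by rewrite !qBl// (si_sym hq (Vv n) (Vu n)) (si_sym hq Vy (Vu n)); ring.
have yM : q y y <= 4 * M.
  have := q_addl2 Vvy (is_subspaceN sV (Vv n)); rewrite addrAC subrr add0r.
  rewrite !(qNl, qNr) ?opprK//; try exact: is_subspaceN.
  have := vM2 _ n2; have : d <= 1 by rewrite /d ge_min lexx.
  by rewrite /M; lra.
have uM : q (u n) (u n) <= M by have := uM1 _ n1; rewrite /M; lra.
have dt : d / t <= e / 8 by rewrite ler_pdivrMr// /d ge_min lexx orbT.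
have ti : 0 < t^-1 by rewrite invr_gt0.
have a1 := q_young t0 Vux Vy; have a2 := q_young t0 Vvy (Vu n).
have b1 : q (u n - x) (u n - x) / t <= e / 8.
  by apply: le_trans dt; rewrite ler_wpM2r// ltW.
have b2 : q (v n - y) (v n - y) / t <= e / 8.
  by apply: le_trans dt; rewrite ler_wpM2r// ltW.
have tM : t * M = e / 8 by rewrite /t; field; rewrite gt_eqF.
have c1 : t * q y y <= e / 2.
  by apply: (le_trans (ler_wpM2l (ltW t0) yM)); rewrite mulrCA tM; lra.
have c2 : t * q (u n) (u n) <= e / 8.
  by apply: (le_trans (ler_wpM2l (ltW t0) uM)); rewrite tM.
by apply: (le_lt_trans (ler_normD _ _)); lra.
Qed.

Lemma q_pair_cvg u v x y : (forall n, V (u n)) -> (forall n, V (v n)) ->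
  V x -> V y -> qcvg q u x -> qcvg q v y ->
  (fun n => q (u n) (v n)) @ \oo --> q x y.
Proof.
move=> Vu Vv Vx Vy ux vy; apply/cvgrPdist_lt => e e0.
have [N [d [d0 h]]] := q_pair_small Vu Vv (qcvg_cauchy Vu Vx ux)
  (qcvg_cauchy Vv Vy vy) e0.
have [N1 u1] := ux _ d0; have [N2 v2] := vy _ d0.
exists (maxn N (maxn N1 N2)) => // n /=; rewrite !geq_max => /and3P[nN n1 n2].
by rewrite distrC; apply: h => //; [exact: u1|exact: v2].
Qed.

Lemma qcvg_cst x : V x -> qcvg q (fun=> x) x.
Proof. by move=> Vx e e0; exists 0%N => n _; rewrite subrr q0l//; case: sV. Qed.

(** A minimizing sequence for the distance to [K] is Cauchy by the parallelogram law. Completeness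
    is asked of [K] only, in the form of sequential limits unique up to null vectors. *)
Lemma orthogonal_projection K : is_subspace K -> K `<=` V ->
  (forall u, (forall n, K (u n)) -> qcauchy q u -> exists2 x, K x & qcvg q u x) ->
  forall w, V w -> exists2 p, K p & forall k, K k -> q (w - p) k = 0.
Proof.
move=> sK KV Kcomplete w Vw.
pose A := [set r | exists2 k, K k & r = q (w - k) (w - k)].
have Vk k : K k -> V (w - k) by move=> Kk; apply: is_subspaceB => //; exact: KV.
have infA : has_inf A.
  split; first by exists (q (w - 0) (w - 0)); exists 0 => //; case: sK.
  by exists 0 => _ [k Kk ->]; exact/(si_ge0 hq)/Vk.
pose dl := inf A.
have dlP k : K k -> dl <= q (w - k) (w - k).
  by move=> Kk; apply: ge_inf; [case: infA|exists k].
have /choice[k kP] : forall n, exists k, K k /\ q (w - k) (w - k) < dl + n.+1%:R^-1.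
  move=> n; have n0 : (0 : R) < n.+1%:R^-1 by rewrite invr_gt0.
  have [_ [k Kk ->] kd] := inf_adherent n0 infA.
  by exists k.
have Kk n : K (k n) by case: (kP n).
have ck : qcauchy q k.
  move=> e e0.
  have [N _ NP] : \forall n \near \oo, (n.+1%:R^-1 : R) < e / 4.
    exact: near_infty_natSinv_lt (PosNum (divr_gt0 e0 _)).
  exists N => m n Nm Nn.
  have hm := NP _ Nm; have hn := NP _ Nn; rewrite /= in hm hn.
  have [_ km] := kP m; have [_ kn] := kP n.
  have Vm := Vk _ (Kk m); have Vn := Vk _ (Kk n).
  (* The midpoint is still at squared distance at least [dl], so the parallelogram law bounds
     [q (k m - k n) (k m - k n)] by [2 / (m + 1) + 2 / (n + 1)]. *)
  have Kmid : K (2^-1 *: (k m + k n)) by apply: is_subspaceZ => //; exact: is_subspaceD.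
  have := dlP _ Kmid.
  have -> : w - 2^-1 *: (k m + k n) = 2^-1 *: (w - k m) + 2^-1 *: (w - k n).
    rewrite -scalerDr addrACA -opprD scalerBr; congr (_ - _).
    by rewrite -[w + w](mulr2n w) -[w *+ 2]scaler_nat scalerA mulVf ?pnatr_eq0// scale1r.
  have -> : k m - k n = (-1) *: (w - k m) + (w - k n).
    by rewrite scaleN1r opprB addrA subrK.
  have Vn2 := is_subspaceZ 2^-1 sV Vn.
  rewrite (q_expand _ Vm Vn2) (q_expand _ Vm Vn).
  move: km kn hm hn; rewrite !qZr ?qZl//.
  set a := q (w - k m) (w - k m); set b := q (w - k n) (w - k n).
  set c := q _ _; set i := m.+1%:R^-1; set j := n.+1%:R^-1.
  move: a b c i j => a b c i j *; nra.
have [p Kp kp] := Kcomplete _ Kk ck.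
have pdl : q (w - p) (w - p) = dl.
  apply/eqP; rewrite eq_le dlP// andbT.
  have Vkn n : V (w - k n) by exact: Vk.
  have wkp : qcvg q (fun n => w - k n) (w - p).
    move=> e /kp[N kN]; exists N => n /kN.
    have -> : w - k n - (w - p) = p - k n by rewrite opprB addrC addrA subrK.
    by rewrite (qsub_sym (KV _ Kp) (KV _ (Kk n))).
  have lim1 := q_pair_cvg Vkn Vkn (Vk _ Kp) (Vk _ Kp) wkp wkp.
  have lim2 : (fun n => dl + n.+1%:R^-1) @ \oo --> dl + (0 : R).
    by apply: cvgD; [exact: cvg_cst|exact: cvg_harmonic].
  rewrite addr0 in lim2.
  apply: (ler_cvg_to lim1 lim2).
  by apply: nearW => n /=; apply: ltW; case: (kP n).
exists p => // z Kz.
have Vz := KV _ Kz; have Vp := Vk _ Kp.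
(* Minimality of [p] compared with the competitor [p - t z]. *)
have h (t : R) : 0 <= t ^+ 2 * q z z + 2 * t * q z (w - p).
  have := dlP _ (is_subspaceB sK Kp (is_subspaceZ t sK Kz)).
  by rewrite opprB addrA addrAC addrC q_expand// pdl; lra.
rewrite (si_sym hq Vp Vz).
have z0 := si_ge0 hq Vz.
set c := q z (w - p) in h *; set a := q z z in h z0.
(* The quadratic is smallest at [- c / a], but [a] may vanish; the denominator [a + 1] still gives a
   negative value unless [c = 0]. *)
have := h (- c / (a + 1)).
have a1 : 0 < a + 1 by lra.
have -> : (- c / (a + 1)) ^+ 2 * a + 2 * (- c / (a + 1)) * c =
   - (c ^+ 2 * ((a + 2) / (a + 1) ^+ 2)).
  by field; rewrite gt_eqF.
rewrite oppr_ge0 pmulr_lle0; last by rewrite divr_gt0 ?exprn_gt0//; lra.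
by move=> c2; apply/eqP; rewrite -sqrf_eq0 eq_le c2 sqr_ge0.
Qed.

End Fixed.
End SemiInner.

(** * The space L^2 *)

Section L2Theory.
Context {d : measure_display} {T : measurableType d} {R : realType}.
Variable mu : {measure set T -> \bar R}.
Implicit Types f g h : T -> R.

Lemma L2P f : L2 mu f <->
  measurable_fun setT f /\ mu.-integrable setT (EFin \o (fun x => f x ^+ 2)).
Proof.
split=> [Lf|[mf sf]].
  split; last exact: Lfun2_integrable_sqr.
  by move: Lf; rewrite /L2/= => /andP[]; rewrite inE.
rewrite /L2/=; apply/andP; split; first by rewrite inE.
rewrite inE/= /finite_norm unlock /Lnorm/=.
move/integrableP : sf => [_ sf].
apply: poweR_lty; apply: le_lt_trans sf.
rewrite le_eqVlt; apply/orP; left; apply/eqP; apply: eq_integral => x _ /=.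
by rewrite powR_mulrn// normrX.
Qed.

Lemma L2_measurable f : L2 mu f -> measurable_fun setT f.
Proof. by move=> /(L2P f).1[]. Qed.

Lemma L2_subspace : is_subspace (L2 mu).
Proof.
have [h0 hl] := @Lfun_submod_closed _ T R mu 2%:E (lee1n 2).
by split; [exact: h0|move=> a f g Lf Lg; exact: hl].
Qed.

Lemma L2_integrableM f g : L2 mu f -> L2 mu g ->
  mu.-integrable setT (EFin \o (fun x => f x * g x)).
Proof. by move=> Lf Lg; apply/Lfun1_integrable/Lfun2_mul_Lfun1. Qed.

Lemma L2ip_semi_inner : semi_inner (L2 mu) (L2ip mu).
Proof.
split; first exact: L2_subspace.
- by move=> f g _ _; rewrite /L2ip; apply: eq_Rintegral => x _; rewrite mulrC.
- move=> a f g h Lf Lg Lh; rewrite /L2ip.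
  rewrite -RintegralZl//; last exact: L2_integrableM.
  rewrite -RintegralD//; last exact: L2_integrableM.
    by apply: eq_Rintegral => x _ /=; rewrite mulrDl mulrA.
  under eq_fun do rewrite mulrA.
  exact: (L2_integrableM (is_subspaceZ a L2_subspace Lf)).
- by move=> f _; apply: Rintegral_ge0 => x _; rewrite -expr2 sqr_ge0.
Qed.

Lemma L2norm_lt f (e : R) : L2 mu f -> 0 < e ->
  (L2norm mu f < e) = (L2ip mu f f < e ^+ 2).
Proof.
move=> Lf e0; have f0 := si_ge0 L2ip_semi_inner Lf.
rewrite -[in RHS](sqr_sqrtr f0) ltr_pXn2r// ?nnegrE ?sqrtr_ge0//.
exact: ltW.
Qed.

Lemma L2cvgP (u : nat -> T -> R) f : (forall n, L2 mu (u n)) -> L2 mu f ->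
  L2cvg mu u f <-> qcvg (L2ip mu) u f.
Proof.
move=> Lu Lf; have Luf n := is_subspaceB L2_subspace (Lu n) Lf.
split=> [/cvgrPdist_lt uf e e0|uf].
  have s0 : 0 < Num.sqrt e by rewrite sqrtr_gt0.
  have [N _ NP] := uf _ s0; exists N => n /NP /=.
  rewrite distrC subr0 ger0_norm ?sqrtr_ge0// L2norm_lt//; last exact: Luf.
  by rewrite sqr_sqrtr// ltW.
apply/cvgrPdist_lt => e e0.
have [N NP] := uf _ (exprn_gt0 2 e0); exists N => // n /NP /=.
by rewrite distrC subr0 ger0_norm ?sqrtr_ge0// L2norm_lt//; exact: Luf.
Qed.

Lemma L2ip_eq0 f : L2 mu f -> L2ip mu f f = 0 <-> L2eq mu f (cst 0).
Proof.
move=> Lf; have [mf sf] := (L2P f).1 Lf.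
have m2 := measurable_int mu sf.
have e2 : (\int[mu]_x `|(f x ^+ 2)%:E| = (L2ip mu f f)%:E)%E.
  rewrite /L2ip /Rintegral fineK; last exact/integrable_fin_num/L2_integrableM.
  by apply: eq_integral => x _; rewrite gee0_abs ?lee_fin ?sqr_ge0// expr2.
have := ae_eq_integral_abs mu measurableT m2; rewrite /= e2 => aeE.
split=> [f0|f0].
- rewrite f0 in aeE; have /aeE := erefl (0%:E : \bar R).
  by apply: filterS => x /= /(_ I) [] /eqP; rewrite sqrf_eq0 => /eqP.
- apply: EFin_inj; apply/aeE.
  by apply: filterS f0 => x /= -> _; rewrite expr0n.
Qed.

Lemma L2eqP f g : L2 mu f -> L2 mu g ->
  L2eq mu f g <-> L2ip mu (f - g) (f - g) = 0.
Proof.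
move=> Lf Lg; rewrite L2ip_eq0; last exact: is_subspaceB L2_subspace _ _.
by split; apply: filterS => x; [move=> fgx; rewrite fctE/= fgx subrr|
  move=> /eqP; rewrite fctE/= subr_eq0 => /eqP].
Qed.

End L2Theory.

(** * Completeness of L^2 for a probability measure *)

Section L2Complete.
Context {d : measure_display} {T : measurableType d} {R : realType}.
Variable P : probability T R.

(* Integrate [|f| <= f^2 / c + c]. *)
Lemma integral_normr_le_L2 (f : T -> R) (c : R) : L2 P f -> 0 < c ->
  L2ip P f f <= c ^+ 2 -> (\int[P]_x `|f x|%:E <= (2 * c)%:E)%E.
Proof.
move=> Lf c0 fc; have [mf sf] := (L2P P f).1 Lf.
have c10 : 0 <= c^-1 by rewrite invr_ge0 ltW.
have h0 : (\int[P]_x (c^-1 * f x ^+ 2 + c)%:E = (c^-1 * L2ip P f f + c)%:E)%E.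
  under eq_integral do rewrite EFinD EFinM.
  have m2 : measurable_fun setT (fun x => (c^-1)%:E * (f x ^+ 2)%:E)%E.
    under eq_fun do rewrite -EFinM; apply/measurable_EFinP.
    by apply: measurable_funM => //; exact: measurable_funX.
  rewrite ge0_integralD//=; last 2 first.
  - by move=> x _; rewrite -EFinM lee_fin mulr_ge0// sqr_ge0.
  - by move=> x _; rewrite lee_fin ltW.
  rewrite ge0_integralZl//=; last 2 first.
  - by apply/measurable_EFinP; exact: measurable_funX.
  - by move=> x _; rewrite lee_fin sqr_ge0.
  rewrite integral_cst//= probability_setT mule1 EFinD EFinM; congr (_ * _ + _)%E.
  rewrite /L2ip /Rintegral fineK; first by apply: eq_integral => x _; rewrite expr2.
  exact/integrable_fin_num/L2_integrableM.
apply: (@le_trans _ _ (c^-1 * L2ip P f f + c)%:E); last first.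
  have := ler_wpM2l c10 fc; rewrite expr2 mulrA mulVf ?gt_eqF// lee_fin; lra.
rewrite -h0; apply: ge0_le_integral => //=.
- exact/measurable_EFinP/measurableT_comp.
- apply/measurable_EFinP; apply: measurable_funD => //.
  by apply: measurable_funM => //; exact: measurable_funX.
move=> x _; rewrite lee_fin -(ler_pM2l c0) mulrDr mulrA divff ?gt_eqF// mul1r.
by rewrite -[f x ^+ 2]real_normK ?num_real//; set y := `|f x|; have := sqr_ge0 (y - c); nra.
Qed.

Lemma nneseries_telescope_cvg (g : nat -> R) :
  (\sum_(j <oo) `|g j.+1 - g j|%:E < +oo)%E -> cvgn g.
Proof.
move=> /nnseries_is_cvg => /(_ (fun=> normr_ge0 _)) /normed_cvg tele.
have {}tele : cvgn (series (telescope g)) by [].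
rewrite telescopeK/= in tele.
rewrite (_ : g = (fun n => g n - g 0%N) \+ cst (g 0%N)).
  by apply: is_cvgD => //; exact: is_cvg_cst.
by apply/funext => n /=; rewrite subrK.
Qed.

(* Along a fast subsequence the increments are summable almost everywhere;
   Fatou's lemma bounds the distance to the pointwise limit. *)
Lemma L2_complete (u : nat -> T -> R) : (forall n, L2 P (u n)) ->
  qcauchy (L2ip P) u -> exists2 f, L2 P f & qcvg (L2ip P) u f.
Proof.
move=> Lu cu; have Lsub := @L2_subspace _ _ _ P.
pose c (j : nat) : R := 1 / (2 ^ (j + 1))%:R.
have c0 j : 0 < c j by rewrite divr_gt0// ltr0n expn_gt0.
have /choice[N NP] : forall j, exists N, forall m n, (N <= m)%N -> (N <= n)%N ->
    L2ip P (u m - u n) (u m - u n) < c j ^+ 2.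
  by move=> j; apply: cu; rewrite exprn_gt0.
(* [sg k] exceeds every [N j] with [j <= k], which controls the increments, and also [k] itself, so
   that late terms of the subsequence are late terms of [u]. *)
pose sg k := (k + \sum_(i < k.+1) N i)%N.
have sgN j k : (j <= k)%N -> (N j <= sg k)%N.
  by move=> jk; rewrite /sg (bigD1 (Ordinal (jk : (j < k.+1)%N)))//= addnCA leq_addr.
pose g j := u (sg j).
have Lg : forall j, L2 P (g j) by move=> j; exact: Lu.
have mg : forall j, measurable_fun setT (g j) by move=> j; exact: L2_measurable (Lg j).
have mgE : forall j, measurable_fun setT (EFin \o g j) by move=> j; exact/measurable_EFinP.
have hle : forall j, (\int[P]_x `|g j.+1 x - g j x|%:E <= (2 * c j)%:E)%E.
  move=> j; apply: (integral_normr_le_L2 (is_subspaceB Lsub (Lg j.+1) (Lg j))) => //.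
  by apply/ltW/NP; exact: sgN.
pose h j x := (`|g j.+1 x - g j x|%:E)%E.
have mh j : measurable_fun setT (h j).
  apply/measurable_EFinP/measurableT_comp => //.
  by apply: measurable_funB.
have h0 j x : (0 <= h j x)%E by rewrite lee_fin.
have mS : measurable_fun setT (fun x => \sum_(j <oo) h j x)%E.
  by apply: ge0_emeasurable_sum => // j x _ _.
have intS : (\int[P]_x (\sum_(j <oo) h j x) < +oo)%E.
  rewrite integral_nneseries//.
  apply: (@le_lt_trans _ _ (\sum_(j <oo) (2%:E * (c j)%:E))%E).
    apply: lee_nneseries => j *; first by apply: integral_ge0.
    by rewrite -EFinM; exact: hle.
  rewrite nneseriesZl => [|j _]; last by rewrite lee_fin ltW.
  have /cvg_lim := @cvg_geometric_eseries_half R 1 0.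
  by rewrite /eseries/= => -> //; rewrite -EFinM ltry.
have aeS : {ae P, forall x, (\sum_(j <oo) h j x < +oo)%E}.
  have iS : P.-integrable setT (fun x => \sum_(j <oo) h j x)%E.
    apply/integrableP; split => //.
    by under eq_integral do rewrite gee0_abs ?nneseries_ge0//.
  have := integrable_ae measurableT iS; apply: filterS => x /(_ I).
  by rewrite fin_numE ltey => /andP[].
(* The upper limit is measurable whether or not the sequence converges at [x]; [fine] makes it
   real-valued and changes it only off the set of convergence. *)
pose F x := limn_esup (fun j => (g j x)%:E).
have mF : measurable_fun setT F by exact: measurable_fun_limn_esup.
pose f x := fine (F x).
have mf : measurable_fun setT f by apply: measurableT_comp => //; exact: fine_measurable.
have aef : {ae P, forall x, (fun j => g j x) @ \oo --> f x}.
  apply: filterS aeS => x /nneseries_telescope_cvg /cvg_ex[l gl].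
  suff -> : f x = l by [].
  rewrite /f /F.
  have glE : (fun j => (g j x)%:E) @ \oo --> l%:E.
    by apply: cvg_EFin => //; exact: nearW.
  by have [_ ->] := cvg_limn_einf_sup glE.
have bound (e : R) m : (exists M, forall n, (M <= n)%N ->
      L2ip P (g n - u m) (g n - u m) <= e) ->
    (\int[P]_x ((f x - u m x) ^+ 2)%:E <= e%:E)%E.
  move=> [M MP].
  pose w j x := ((g j x - u m x) ^+ 2)%:E.
  have mum := L2_measurable (Lu m).
  have mw j : measurable_fun setT (w j).
    by apply/measurable_EFinP/measurable_funX; apply: measurable_funB.
  have w0 j x : setT x -> (0 <= w j x)%E by move=> _; rewrite lee_fin sqr_ge0.
  have -> : (\int[P]_x ((f x - u m x) ^+ 2)%:E = \int[P]_x limn_einf (w ^~ x))%E.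
    apply: ae_eq_integral => //.
    - by apply/measurable_EFinP/measurable_funX; apply: measurable_funB.
    - rewrite /limn_einf; apply: measurableT_comp => //.
      by apply: measurable_fun_limn_esup => j; exact: measurableT_comp.
    apply: filterS aef => x gx _.
    suff wx : (w ^~ x) @ \oo --> ((f x - u m x) ^+ 2)%:E.
      by have [-> _] := cvg_limn_einf_sup wx.
    apply: cvg_EFin; first exact: nearW.
    have gu : (fun j => g j x - u m x) @ \oo --> f x - u m x.
      by apply: cvgB => //; exact: cvg_cst.
    by rewrite expr2; exact: (cvgM gu gu).
  apply: (le_trans (fatou P measurableT mw w0)).
  rewrite limn_einf_lim; apply: lime_le; first exact: is_cvg_einfs.
  apply: nearW => n; apply: ge_ereal_inf.
  exists (\int[P]_x w (maxn n M) x)%E; first by exists (maxn n M) => //=; exact: leq_maxl.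
  have Lgm := is_subspaceB Lsub (Lg (maxn n M)) (Lu m).
  rewrite (_ : integral _ _ _ = (L2ip P (g (maxn n M) - u m) (g (maxn n M) - u m))%:E).
    by rewrite lee_fin; apply: MP; exact: leq_maxr.
  rewrite /L2ip /Rintegral fineK; last exact/integrable_fin_num/L2_integrableM.
  by apply: eq_integral => x _; rewrite /w expr2.
have ev (e : R) : 0 < e -> exists M, forall m, (M <= m)%N ->
    L2 P (f - u m) /\ L2ip P (f - u m) (f - u m) <= e.
  move=> e0; have [M MP] := cu _ e0; exists M => m Mm.
  have le_e : (\int[P]_x ((f x - u m x) ^+ 2)%:E <= e%:E)%E.
    apply: bound; exists M => n Mn; apply/ltW/MP => //.
    by rewrite (leq_trans Mn)// leq_addr.
  have mum := L2_measurable (Lu m).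
  have Lfu : L2 P (f - u m).
    apply/(L2P P (f - u m)); split; first exact: measurable_funB.
    apply/integrableP; split.
      by apply/measurable_EFinP/measurable_funX; apply: measurable_funB.
    apply: le_lt_trans (ltry e); apply: le_trans le_e.
    rewrite le_eqVlt; apply/orP; left; apply/eqP; apply: eq_integral => x _ /=.
    by rewrite ger0_norm ?sqr_ge0.
  split => //; rewrite -lee_fin; apply: le_trans le_e.
  rewrite /L2ip /Rintegral fineK; last exact/integrable_fin_num/L2_integrableM.
  by rewrite le_eqVlt; apply/orP; left; apply/eqP; apply: eq_integral => x _; rewrite expr2.
have Lf : L2 P f.
  have [M /(_ _ (leqnn M))[LfM _]] := ev _ ltr01.
  by rewrite -(subrK (u M) f); exact: is_subspaceD.
exists f => // e e0; have [M MP] := ev _ (divr_gt0 e0 (ltr0n _ 2 : 0 < 2%:R)).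
exists M => m /MP[_]; rewrite (qsub_sym (@L2ip_semi_inner _ _ _ P))//.
by move=> /le_lt_trans; apply; lra.
Qed.

End L2Complete.

(** * Closure of a symmetric form *)

Lemma real_cauchy_cvg (R : realType) (s : nat -> R) :
  (forall e : R, 0 < e -> exists N, forall m n, (N <= m)%N -> (N <= n)%N ->
    `|s m - s n| < e) -> cvgn s.
Proof.
move=> cs; apply/cauchy_cvgP/cauchy_exP => e e0.
have [N NP] := cs _ e0; exists (s N); exists N => // n /= Nn.
exact: NP.
Qed.

Lemma eq_cvg_to (R : realType) (s s' : nat -> R) (l : R) :
  s =1 s' -> s' @ \oo --> l -> s @ \oo --> l.
Proof. by move=> /funext ->. Qed.

Lemma real_cvg_unique (R : realType) (s : nat -> R) (a b : R) :
  s @ \oo --> a -> s @ \oo --> b -> a = b.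
Proof. by move=> sa sb; exact: (cvg_unique _ sa sb). Qed.

Lemma ex_null_seq (R : realType) : exists2 s : nat -> R, forall n, 0 < s n &
  forall e, 0 < e -> exists N, forall n, (N <= n)%N -> s n < e.
Proof.
exists (fun n => n.+1%:R^-1) => [n|e e0]; first by rewrite invr_gt0.
by have [N _ NP] := near_infty_natSinv_lt (PosNum e0); exists N.
Qed.

Lemma ltr_quarters (R : realFieldType) (x y z e : R) :
  x <= 2 * y + 2 * z -> y < e / 4 -> z < e / 4 -> x < e.
Proof. by lra. Qed.

Section FormClosure.
Context {d : measure_display} {T : measurableType d} {R : realType}.
Variables (mu : {measure set T -> \bar R}) (D : set (T -> R)).
Variables (q : (T -> R) -> (T -> R) -> R) (S : (T -> R) -> T -> R).
Hypotheses (DL2 : D `<=` L2 mu) (SL2 : forall f, D f -> L2 mu (S f)).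
Hypothesis qD : semi_inner D q.
Hypothesis qS : forall f h, D f -> D h -> q f h = - L2ip mu f (S h).

Let ip := @L2ip_semi_inner _ _ _ mu.
Let sL2 := @L2_subspace _ _ _ mu.
Let sD := si_sub qD.

(** Split [q (u n) (u n)] as [q (u n - u m) (u n) + q (u m) (u n)]. The first term is small by the
    Cauchy property; the second is [- <u m, S (u n)>], which tends to 0 as [m] grows with [n] fixed,
    since [S (u n)] is in L^2. *)
Lemma form_closable (u : nat -> T -> R) : (forall n, D (u n)) ->
  qcauchy q u -> qcvg (L2ip mu) u 0 -> qcvg q u 0.
Proof.
move=> Du cu u0 e e0.
have e16 : 0 < e / 16 by rewrite divr_gt0.
have [N NP] := cu _ e16; exists N => n Nn; rewrite subr0.
have Lu m : L2 mu (u m) by exact/DL2.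
have L0 : L2 mu 0 by case: sL2.
have lim0 := q_pair_cvg ip Lu (fun=> SL2 (Du n)) L0 (SL2 (Du n)) u0
  (qcvg_cst ip (SL2 (Du n))).
rewrite (q0l ip (SL2 (Du n))) in lim0.
have /cvgrPdist_lt /(_ _ e16)[M _ MP] := lim0.
have Mm := MP (maxn N M) (leq_maxr _ _).
have Nm := NP _ _ Nn (leq_maxl N M).
set m := maxn N M in Mm Nm.
rewrite /= sub0r normrN in Mm.
(* With parameter 1/2, Young's inequality leaves half of [q (u n) (u n)], absorbed on the left; what
   remains is at most 3e/8. *)
have half0 : (0 : R) < 2^-1 by rewrite invr_gt0.
have yg := q_young qD half0 (is_subspaceB sD (Du n) (Du m)) (Du n).
rewrite invrK in yg.
have eq1 : q (u n) (u n) = q (u n - u m) (u n) + q (u m) (u n).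
  by rewrite (qBl qD)// subrK.
have a1 := ler_norm (q (u n - u m) (u n)).
have a2 : q (u m) (u n) <= `|L2ip mu (u m) (S (u n))|.
  by rewrite qS// -normrN ler_norm.
move: eq1 yg a1 a2 Mm Nm.
set x := q (u n) (u n); set y := q _ (u n); set z := q _ (u n).
set w := q _ _; set i := L2ip _ _ _; set j := `|y|; set k := `|i|.
move: x y z w i j k => x y z w i j k; lra.
Qed.

Definition represents (u : nat -> T -> R) (f : T -> R) :=
  [/\ forall n, D (u n), L2cvg mu u f & form_cauchy q u].

Lemma represents_lin (a : R) u v f g : L2 mu f -> L2 mu g ->
  represents u f -> represents v g ->
  represents (fun n => a *: u n + v n) (a *: f + g).
Proof.
move=> Lf Lg [Du uf cu] [Dv vg cv].
have Lu n : L2 mu (u n) by exact/DL2.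
have Lv n : L2 mu (v n) by exact/DL2.
split; first by move=> n; exact: sD.2.
- apply/L2cvgP; [by move=> n; apply: sL2.2|exact: sL2.2|].
  by apply: (qcvg_lin ip) => //; exact/L2cvgP.
- exact: (qcauchy_lin qD).
Qed.

Lemma represents_cst f : D f -> represents (fun=> f) f.
Proof.
move=> Df; split => //.
  by apply/L2cvgP => //; [move=> _; exact: DL2|exact: DL2|exact/(qcvg_cst ip)/DL2].
exact: (qcvg_cauchy qD (fun=> Df) Df (qcvg_cst qD Df)).
Qed.

(** The difference represents 0, so closability applies. This is the independence of [form_closure]
    from the approximating sequences. *)
Lemma represents_close u u' f : L2 mu f -> represents u f -> represents u' f ->
  qcvg q (fun n => u' n - u n) 0.
Proof.
move=> Lf ru ru'.
have [Dw w0 cw] := represents_lin (-1) Lf Lf ru ru'.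
have wE : (fun n => -1 *: u n + u' n) = (fun n => u' n - u n).
  by apply/funext => n; rewrite scaleN1r addrC.
rewrite wE in w0 cw; rewrite scaleN1r addNr in w0.
have {}Dw n : D (u' n - u n) by have := Dw n; rewrite scaleN1r addrC.
apply: form_closable => //; apply/L2cvgP => //.
  by move=> n; exact: DL2.
by case: sL2.
Qed.

Local Notation V := (form_closure_dom mu D q).
Local Notation fc := (form_closure mu D q).

Lemma form_closure_cvg u v f h : L2 mu f -> L2 mu h ->
  represents u f -> represents v h ->
  (fun n => q (u n) (v n)) @ \oo --> fc f h.
Proof.
move=> Lf Lh ru rv.
have [Du uf cu] := ru; have [Dv vh cv] := rv.
have /cvg_ex[l ul] : cvgn (fun n => q (u n) (v n)).
  apply: real_cauchy_cvg => e e0.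
  have [N [dl [dl0 NP]]] := q_pair_small qD Du Dv cu cv e0.
  have [N1 uN1] := cu _ dl0; have [N2 vN2] := cv _ dl0.
  exists (maxn N (maxn N1 N2)) => m n.
  rewrite !geq_max => /and3P[mN mN1 mN2] /and3P[nN nN1 nN2].
  by apply: NP => //; [exact: uN1|exact: vN2].
rewrite /form_closure.
set Q := [set c | _].
(* The set of possible limits is not empty, so [xget] does not return its default 0; it remains to
   compare the sequences it happened to use with [u] and [v]. *)
have : Q (xget 0 Q).
  by apply: xgetPex; exists l; exists u, v; split.
move: (xget 0 Q) => c [u' [v' [[Du' Dv'] [u'f v'h] [cu' cv'] c'c]]].
suff : (fun n => q (u n) (v n) - q (u' n) (v' n)) @ \oo --> (0 : R).
  move=> dif; rewrite -[c]add0r.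
  apply: (eq_cvg_to _ (cvgD dif c'c)) => n.
  by rewrite /= subrK.
apply/cvgrPdist_lt => e e0.
have [N [dl [dl0 NP]]] := q_pair_small qD Du Dv cu cv e0.
have [N1 uN1] := represents_close Lf (And3 Du' u'f cu') ru dl0.
have [N2 vN2] := represents_close Lh (And3 Dv' v'h cv') rv dl0.
exists (maxn N (maxn N1 N2)) => // n /=; rewrite !geq_max => /and3P[nN nN1 nN2].
rewrite sub0r normrN; apply: NP => //.
  by have := uN1 _ nN1; rewrite subr0.
by have := vN2 _ nN2; rewrite subr0.
Qed.

Lemma form_closureE f h : D f -> D h -> fc f h = q f h.
Proof.
move=> Df Dh; have := form_closure_cvg (DL2 Df) (DL2 Dh)
  (represents_cst Df) (represents_cst Dh).
by move=> /(real_cvg_unique (cvg_cst _)) <-.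
Qed.

Lemma sub_form_closure_dom : D `<=` V.
Proof.
move=> f Df; split; first exact: DL2.
by exists (fun=> f); exact: represents_cst.
Qed.

Lemma form_closure_semi_inner : semi_inner V fc.
Proof.
split.
- split; first by apply: sub_form_closure_dom; case: sD.
  move=> a f g [Lf [u ru]] [Lg [v rv]]; split; first exact: sL2.2.
  by exists (fun n => a *: u n + v n); exact: represents_lin.
- move=> f g [Lf [u ru]] [Lg [v rv]].
  have h1 := form_closure_cvg Lf Lg ru rv.
  have h2 := form_closure_cvg Lg Lf rv ru.
  apply: (real_cvg_unique h1); apply: (eq_cvg_to _ h2) => n.
  by apply: (si_sym qD); [case: ru|case: rv].

- move=> a f g h [Lf [u ru]] [Lg [v rv]] [Lh [w rw]].
  have h1 := form_closure_cvg Lf Lh ru rw.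
  have h2 := form_closure_cvg Lg Lh rv rw.
  have h3 := form_closure_cvg (sL2.2 a _ _ Lf Lg) Lh (represents_lin a Lf Lg ru rv) rw.
  apply: (real_cvg_unique h3).
  apply: (@eq_cvg_to _ _ (fun n => a * q (u n) (w n) + q (v n) (w n))) => [n|].
    by apply: (si_lin qD); [case: ru|case: rv|case: rw].
  exact: (cvgD (cvgM (cvg_cst a) h1) h2).
- move=> f [Lf [u ru]].
  apply: (ler_cvg_to (cvg_cst 0) (form_closure_cvg Lf Lf ru ru)).
  by apply: nearW => n; apply: (si_ge0 qD); case: ru.
Qed.

Let fcI := form_closure_semi_inner.
Let sV := si_sub fcI.

Lemma represents_cvg u f : L2 mu f -> represents u f -> qcvg fc u f.
Proof.
move=> Lf ru e e0; have [Du uf cu] := ru.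
have e2 : 0 < e / 2 by rewrite divr_gt0.
have [N NP] := cu _ e2; exists N => n Nn.
apply: (@le_lt_trans _ _ (e / 2)); last by lra.
have Lun := DL2 (Du n).
(* For fixed [n], the energy of [u n - f] is thus the limit in [m] of [q (u n - u m) (u n - u m)],
   which the Cauchy property bounds. *)
have rd : represents (fun m => u n - u m) (u n - f).
  have := represents_lin (-1) Lf Lun ru (represents_cst (Du n)).
  rewrite scaleN1r [- f + _]addrC; congr represents.
  by apply/funext => m; rewrite scaleN1r addrC.
have Ld := is_subspaceB sL2 Lun Lf.
apply: (ler_cvg_to (form_closure_cvg Ld Ld rd rd) (cvg_cst _)).
by exists N => // m /= Nm; apply/ltW/NP.
Qed.

Lemma form_closure_approx f (e : R) : V f -> 0 < e ->
  exists2 g, D g & fc (g - f) (g - f) < e /\ L2ip mu (g - f) (g - f) < e.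
Proof.
move=> [Lf [u ru]] e0; have [Du uf cu] := ru.
have [N1 h1] := represents_cvg Lf ru e0.
have [N2 h2] := (L2cvgP (fun n => DL2 (Du n)) Lf).1 uf _ e0.
exists (u (maxn N1 N2)) => //; split; [exact/h1/leq_maxl|exact/h2/leq_maxr].
Qed.

(** Diagonal argument: replace each [u n] by an element of [D] within [1 / (n + 1)] of it in both
    squared norms; the new sequence represents [f]. For a constant sequence, it shows that the form
    domain is stable under almost everywhere equality. *)
Lemma form_closure_closed (u : nat -> T -> R) f : (forall n, V (u n)) ->
  L2 mu f -> qcvg (L2ip mu) u f -> qcauchy fc u -> V f /\ qcvg fc u f.
Proof.
move=> Vu Lf uf cu.
have Lu n : L2 mu (u n) by case: (Vu n).
have [iv i0 inv_small] := @ex_null_seq R.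
have /choice[v vP] : forall n, exists v, D v /\ (fc (v - u n) (v - u n) < iv n
    /\ L2ip mu (v - u n) (v - u n) < iv n).
  by move=> n; have [v Dv h] := form_closure_approx (Vu n) (i0 n); exists v.
have Dv n : D (v n) by case: (vP n).
have Vv n : V (v n) by exact: sub_form_closure_dom.
have Lv n : L2 mu (v n) by exact: DL2.
have vf : qcvg (L2ip mu) v f.
  move=> e e0; have e4 : 0 < e / 4 by rewrite divr_gt0.
  have [N1 h1] := uf _ e4; have [N2 h2] := inv_small _ e4.
  exists (maxn N1 N2) => n; rewrite geq_max => /andP[n1 n2].
  have [_ [_ vn]] := vP n.
  exact: (ltr_quarters (q_trans ip (Lv n) (Lu n) Lf) (lt_trans vn (h2 _ n2)) (h1 _ n1)).
have cv : qcauchy fc v.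
  move=> e e0; have e4 : 0 < e / 4 by rewrite divr_gt0.
  have e16 : 0 < e / 4 / 4 by rewrite divr_gt0.
  have [N1 h1] := cu _ e16; have [N2 h2] := inv_small _ e16.
  exists (maxn N1 N2) => m n; rewrite !geq_max => /andP[m1 m2] /andP[n1 n2].
  have [_ [vm _]] := vP m; have [_ [vn _]] := vP n.
  rewrite (qsub_sym fcI (Vv n) (Vu n)) in vn.
  apply: (ltr_quarters (q_trans fcI (Vv m) (Vu m) (Vv n))).
    apply: (lt_trans vm); apply: (lt_trans (h2 _ m2)).
    by rewrite ltr_pdivrMr// ltr_pMr// ltr1n.
  exact: (ltr_quarters (q_trans fcI (Vu m) (Vu n) (Vv n)) (h1 _ _ m1 n1)
    (lt_trans vn (h2 _ n2))).
have rv : represents v f.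
  split => //; first exact/L2cvgP.
  move=> e /cv[N NP]; exists N => m n Nm Nn.
  by have := NP _ _ Nm Nn; rewrite form_closureE//; exact: is_subspaceB.
have Vf : V f by split => //; exists v.
split => // e e0; have e4 : 0 < e / 4 by rewrite divr_gt0.
have [N1 h1] := represents_cvg Lf rv e4; have [N2 h2] := inv_small _ e4.
exists (maxn N1 N2) => n; rewrite geq_max => /andP[n1 n2].
have [_ [vn _]] := vP n.
rewrite (qsub_sym fcI (Vv n) (Vu n)) in vn.
exact: (ltr_quarters (q_trans fcI (Vu n) (Vv n) Vf) (lt_trans vn (h2 _ n2)) (h1 _ n1)).
Qed.

(** The adjoint condition of the Friedrichs extension becomes the weak equation on the whole form
    domain: first approximate [f] with [h] in [D] fixed, then approximate [h]. *)
Lemma form_closure_weak f g : V f -> L2 mu g ->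
  (forall h, D h -> L2ip mu f (S h) = L2ip mu g h) ->
  forall h, V h -> fc f h = - L2ip mu g h.
Proof.
move=> Vf Lg fg.
have Dcase h : D h -> fc f h = - L2ip mu g h.
  move=> Dh; have [Lf [u ru]] := Vf; have [Du uf cu] := ru.
  have Lu n := DL2 (Du n).
  have h1 := form_closure_cvg Lf (DL2 Dh) ru (represents_cst Dh).
  apply: (real_cvg_unique h1); rewrite -fg//.
  apply: (@eq_cvg_to _ _ (fun n => - L2ip mu (u n) (S h))) => [n|]; first exact: qS.
  apply: cvgN; apply: (q_pair_cvg ip) => //; [|exact: SL2|exact/L2cvgP|].
    by move=> _; exact: SL2.
  exact/(qcvg_cst ip)/SL2.
move=> h Vh; have [Lh [v rv]] := Vh; have [Dv vh cv] := rv.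
have Lv n := DL2 (Dv n).
have h1 := q_pair_cvg fcI (fun=> Vf) (fun n => sub_form_closure_dom (Dv n)) Vf Vh
  (qcvg_cst fcI Vf) (represents_cvg Lh rv).
apply: (real_cvg_unique h1).
apply: (@eq_cvg_to _ _ (fun n => - L2ip mu g (v n))) => [n|]; first exact: Dcase.
apply: cvgN; apply: (q_pair_cvg ip) => //; last exact/L2cvgP.
exact: (qcvg_cst ip).
Qed.

End FormClosure.

(** * Eigenfunction expansions and the closure of the range *)

Lemma small_eq0 (R : realFieldType) (x : R) :
  0 <= x -> (forall e, 0 < e -> x < e) -> x = 0.
Proof.
move=> x0 xe; apply/eqP; rewrite eq_le x0 andbT.
by apply/ler_addgt0Pl => e e0; rewrite addr0 ltW// xe.
Qed.

Section L2eqTheory.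
Context {d : measure_display} {T : measurableType d} {R : realType}.
Variable mu : {measure set T -> \bar R}.
Implicit Types f g h : T -> R.

Lemma L2eq_sym f g : L2eq mu f g -> L2eq mu g f.
Proof. by apply: filterS => x ->. Qed.

Lemma L2eq_trans g f h : L2eq mu f g -> L2eq mu g h -> L2eq mu f h.
Proof. by apply: filterS2 => x -> ->. Qed.

Lemma L2eq_lin (a : R) f g f' g' : L2eq mu f f' -> L2eq mu g g' ->
  L2eq mu (fun x => a * f x + g x) (fun x => a * f' x + g' x).
Proof. by apply: filterS2 => x -> ->. Qed.

Lemma L2eq_ip f g h : L2 mu f -> L2 mu g -> L2 mu h -> L2eq mu f g ->
  L2ip mu f h = L2ip mu g h.
Proof.
move=> Lf Lg Lh /(L2eqP Lf Lg) fg0; apply/eqP; rewrite -subr_eq0.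
have ip := @L2ip_semi_inner _ _ _ mu.
rewrite -(qBl ip)//; apply/eqP; apply: (q_eq0 ip) => //.
exact: is_subspaceB (si_sub ip) _ _.
Qed.

End L2eqTheory.

Section Spectral.
Context {d : measure_display} {T : measurableType d} {R : realType}.
Variables (P : probability T R) (D : set (T -> R)).
Variables (q : (T -> R) -> (T -> R) -> R) (S : (T -> R) -> T -> R).
Hypotheses (DL2 : D `<=` L2 P) (SL2 : forall f, D f -> L2 P (S f)).
Hypothesis qD : semi_inner D q.
Hypothesis qS : forall f h, D f -> D h -> q f h = - L2ip P f (S h).
Variables (A : @operator _ T R) (ev : nat -> R) (phi : nat -> T -> R).
Hypothesis AE : friedrichs_extension P D S A.
Hypothesis Asp : discrete_spectrum P A ev phi.

Local Notation V := (form_closure_dom P D q).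
Local Notation fc := (form_closure P D q).
Local Notation ip := (L2ip P).

Let ipI := @L2ip_semi_inner _ _ _ P.
Let sL2 := @L2_subspace _ _ _ P.
Let sD := si_sub qD.
Let fcI := form_closure_semi_inner DL2 SL2 qD qS.
Let sV := si_sub fcI.
Let Lphi := phi_L2 Asp.

(** The definition uses the form [- <S u, v>], which agrees with [q] on [D]; only differences of
    elements of [D] enter the Cauchy condition. *)
Lemma friedrichsP f g : A f g <->
  [/\ L2 P f, L2 P g, V f & forall h, D h -> ip f (S h) = ip g h].
Proof.
have qE u m n : (forall n, D (u n)) -> - ip (S (u m \- u n)) (u m \- u n) =
    q (u m \- u n) (u m \- u n).
  move=> Du; have Dd : D (u m - u n) by exact: is_subspaceB.
  by rewrite qS// (si_sym ipI)//; [exact: SL2|exact: DL2].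
rewrite AE.2; split=> -[Lf Lg [_ [u [Du uf cu]]] fg]; split => //; split => //;
  exists u; split => // e /cu[N NP]; exists N => m n Nm Nn.
- by rewrite -qE//; exact: NP.
- by rewrite qE//; exact: NP.
Qed.

Lemma eigen_dom k : V (phi k).
Proof. by have /friedrichsP[] := phi_eigen Asp k. Qed.

Lemma eigen_form k h : V h -> fc (phi k) h = ev k * ip (phi k) h.
Proof.
move=> Vh; have /friedrichsP[_ Lg _ fg] := phi_eigen Asp k.
rewrite (form_closure_weak DL2 SL2 qD qS (eigen_dom k) Lg fg Vh).
have Lh : L2 P h by case: Vh.
by rewrite (qZl ipI (- ev k) (Lphi k) Lh) mulNr opprK.
Qed.

(** An arbitrary list of indices covers both the partial sums and their differences, which are sums
    over blocks. *)
Definition esum_on (r : seq nat) (a : nat -> R) : T -> R :=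
  \sum_(k <- r) a k *: phi k.

Lemma psum1E a n : psum1 a phi n = esum_on (index_iota 1 n.+1) a.
Proof. by apply/funext => x; rewrite /psum1 /esum_on fct_sumE. Qed.

Lemma esum_onV r a : V (esum_on r a).
Proof.
rewrite /esum_on; elim/big_ind : _ => [|f g|k _]; first by case: sV.
  exact: is_subspaceD.
by apply: is_subspaceZ => //; exact: eigen_dom.
Qed.

Lemma esum_onL2 r a : L2 P (esum_on r a).
Proof. by case: (esum_onV r a). Qed.

Lemma esum_on_ip r a h : L2 P h -> ip (esum_on r a) h = \sum_(k <- r) a k * ip (phi k) h.
Proof.
move=> Lh; rewrite /esum_on.
rewrite (q_suml ipI r (P := xpredT) (F := fun k => a k *: phi k) _ Lh).2.
  by apply: eq_bigr => k _; rewrite (qZl ipI).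
by move=> k _; apply: is_subspaceZ.
Qed.

Lemma esum_on_form r a h : V h ->
  fc (esum_on r a) h = \sum_(k <- r) a k * (ev k * ip (phi k) h).
Proof.
move=> Vh; rewrite /esum_on.
rewrite (q_suml fcI r (P := xpredT) (F := fun k => a k *: phi k) _ Vh).2.
  by apply: eq_bigr => k _; rewrite (qZl fcI) ?eigen_form//; exact: eigen_dom.
by move=> k _; apply: is_subspaceZ => //; exact: eigen_dom.
Qed.

Lemma esum_on_coef r a j : uniq r ->
  ip (phi j) (esum_on r a) = if j \in r then a j else 0.
Proof.
move=> ur; rewrite (si_sym ipI) ?esum_on_ip//; last exact: esum_onL2.
under eq_bigr do rewrite (phi_orthonormal Asp).
case: ifPn => jr.
  rewrite (bigD1_seq j)//= eqxx mulr1 big1 ?addr0// => k /negbTE ->.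
  by rewrite mulr0.
rewrite big_seq big1// => k kr; rewrite (negbTE (_ : k != j)) ?mulr0//.
by apply: contraNneq jr => <-.
Qed.

Lemma esum_on_energy r a : uniq r ->
  fc (esum_on r a) (esum_on r a) = \sum_(k <- r) ev k * a k ^+ 2.
Proof.
move=> ur; rewrite esum_on_form; last exact: esum_onV.
rewrite big_seq [RHS]big_seq; apply: eq_bigr => k kr.
by rewrite esum_on_coef// kr expr2 mulrCA.
Qed.

Lemma ev_ge0 k : 0 <= ev k.
Proof. by rewrite -(ev_0 Asp) (ev_nondecreasing Asp). Qed.

Lemma psum1_diff a m n : (m <= n)%N ->
  psum1 a phi n - psum1 a phi m = esum_on (index_iota m.+1 n.+1) a.
Proof.
by move=> mn; rewrite !psum1E /esum_on (big_cat_nat (ltn0Sn m))//= addrAC subrr add0r.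
Qed.

(** The energy of a block of the expansion is the corresponding block of the convergent numerical
    series, so the partial sums are Cauchy in energy and closedness of the form applies.
    Orthogonality to [phi 0] holds because indices start at 1. *)
Lemma sobolev1_expansion a f : L2 P f ->
  cvgn (fun n => \sum_(1 <= k < n.+1) `|a k| ^+ 2 * ev k ^+ 1) ->
  L2cvg P (psum1 a phi) f ->
  [/\ V f, ip f (phi 0%N) = 0, qcvg fc (psum1 a phi) f & qcvg ip (psum1 a phi) f].
Proof.
move=> Lf ca af.
have Vp n : V (psum1 a phi n) by rewrite psum1E; exact: esum_onV.
have Lp n : L2 P (psum1 a phi n) by case: (Vp n).
have {}af : qcvg ip (psum1 a phi) f by exact/L2cvgP.
have cp : qcauchy fc (psum1 a phi).
  suff h (e : R) : 0 < e -> exists N, forall m n, (N <= m)%N -> (m <= n)%N ->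
      fc (psum1 a phi n - psum1 a phi m) (psum1 a phi n - psum1 a phi m) < e.
    move=> e /h[N NP]; exists N => m n Nm Nn.
    have [mn|/ltnW nm] := leqP m n; last exact: NP.
    by rewrite (qsub_sym fcI)//; exact: NP.
  move=> e0.
  have [N _ NP] : \forall n \near \oo,
      `|limn (fun n => \sum_(1 <= k < n.+1) `|a k| ^+ 2 * ev k ^+ 1) -
      \sum_(1 <= k < n.+1) `|a k| ^+ 2 * ev k ^+ 1| < e / 2.
    by move/cvgrPdist_lt : ca; apply; rewrite divr_gt0.
  exists N => m n Nm mn.
  rewrite psum1_diff// esum_on_energy ?iota_uniq//.
  have := NP _ Nm; have := NP _ (leq_trans Nm mn); rewrite /= distrC => hn hm.
  have := le_lt_trans (ler_normD _ _) (ltrD hn hm).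
  rewrite subrKA -splitr; apply: le_lt_trans.
  rewrite [X in `|X - _|](big_cat_nat (ltn0Sn m))//= addrAC subrr add0r.
  apply: le_trans (ler_norm _); rewrite le_eqVlt; apply/orP; left; apply/eqP.
  by apply: eq_bigr => k _; rewrite expr1 mulrC real_normK// num_real.
have [Vf fcv] := form_closure_closed DL2 SL2 qD qS Vp Lf af cp.
split => //.
have h1 := q_pair_cvg ipI Lp (fun=> Lphi 0) Lf (Lphi 0) af (qcvg_cst ipI (Lphi 0)).
apply: (real_cvg_unique h1); apply: (@eq_cvg_to _ _ (fun=> 0)) => [n|]; last exact: cvg_cst.
rewrite (si_sym ipI)// psum1E esum_on_coef ?iota_uniq//.
by rewrite mem_index_iota.
Qed.

(** This makes H^1 accessible to the form methods. For the converse, Bessel's inequality in energy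
    bounds the series by [fc f f]. *)
Lemma sobolev1P f : sobolev P ev phi 1 f <-> V f /\ ip f (phi 0%N) = 0.
Proof.
split=> [[Lf [a [ca af]]]|[Vf f0]].
  by have [] := sobolev1_expansion Lf ca af.
have Lf : L2 P f by case: Vf.
split => //; pose a k := ip f (phi k); exists a.
have Vp n : V (psum1 a phi n) by rewrite psum1E; exact: esum_onV.
split.
  apply: nondecreasing_is_cvgn.
    apply/nondecreasing_seqP => n; rewrite [leRHS]big_nat_recr//= lerDl.
    by rewrite mulr_ge0 ?sqr_ge0// expr1 ev_ge0.
  exists (fc f f) => _ [n _ <-].
  have -> : \sum_(1 <= k < n.+1) `|a k| ^+ 2 * ev k ^+ 1 =
      fc (psum1 a phi n) (psum1 a phi n).
    rewrite psum1E esum_on_energy ?iota_uniq//.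
    by apply: eq_bigr => k _; rewrite expr1 mulrC real_normK// num_real.
  have := si_ge0 fcI (is_subspaceB sV Vf (Vp n)).
  (* The partial sum is the energy projection of [f], so its energy is that of [f] minus that of the
     remainder. *)
  have e1 : fc (psum1 a phi n) f = fc (psum1 a phi n) (psum1 a phi n).
    rewrite psum1E esum_on_form// esum_on_energy ?iota_uniq//.
    apply: eq_bigr => k _; rewrite (si_sym ipI)// -/(a k) expr2.
    by rewrite mulrCA.
  rewrite (q_sub_proj fcI Vf (Vp n) e1).
  by rewrite subr_ge0.
(* Completeness sums over [k < n] from index 0; the term at 0 vanishes by [f0], and the shift by one
   accounts for the upper bound [n.+1] in [psum1]. *)
have := phi_complete Asp Lf; rewrite /L2cvg -cvg_shiftS => h.
apply: (eq_cvg_to _ h) => n /=; congr (L2norm _ _).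
apply/funext => x; congr (_ - _).
rewrite -(big_mkord xpredT (fun k => ip f (phi k) * phi k x)) big_ltn//.
by rewrite f0 mul0r add0r.
Qed.

Lemma sobolev_psum m a n : sobolev P ev phi m (psum1 a phi n).
Proof.
have Lp : L2 P (psum1 a phi n) by rewrite psum1E; exact: esum_onL2.
(* Cutting the coefficients off makes the numerical series and the expansion eventually constant,
   whatever the Sobolev exponent. *)
pose a' k := if (k < n.+1)%N then a k else 0.
have tail (F : nat -> R) N : (n <= N)%N -> (forall k, (n < k)%N -> F k = 0) ->
    \sum_(1 <= k < N.+1) F k = \sum_(1 <= k < n.+1) F k.
  move=> nN F0; rewrite (big_cat_nat (ltn0Sn n))//= [X in _ + X](_ : _ = 0) ?addr0//.
  rewrite big_nat_cond big1//.
  by move=> k /andP[/andP[nk _] _]; exact: F0.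
have a'0 k : (n < k)%N -> a' k = 0 by rewrite /a' ltnS ltnNge => /negbTE ->.
split => //; exists a'; split.
  apply/cvg_ex; exists (\sum_(1 <= k < n.+1) `|a' k| ^+ 2 * ev k ^+ m).
  apply: cvg_near_cst; exists n => // N nN.
  apply: (tail (fun k => `|a' k| ^+ 2 * ev k ^+ m)) => // k nk.
  by rewrite a'0// normr0 expr0n/= mul0r.
apply: cvg_near_cst; exists n => // N /= nN.
suff -> : psum1 a' phi N \- psum1 a phi n = 0.
  by rewrite /L2norm (q0l ipI) ?sqrtr0//; case: sL2.
apply/funext => x; apply/eqP; rewrite subr_eq0; apply/eqP.
apply: (etrans (tail (fun k => a' k * phi k x) N nN _)) => [k nk|].
  by rewrite a'0// mul0r.
by apply: eq_big_nat => k /andP[_ kn]; rewrite /a' kn.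
Qed.

(** * The kernel of [B] in H^1 and the range of the projected resolvent *)

Section Projection.
Variable B : (T -> R) -> T -> R.
Local Notation H1 := (sobolev P ev phi 1).
Local Notation H := (sobolev P ev phi 0).
Hypothesis BH : forall f, H1 f -> H (B f).
Hypothesis B_lin : forall (a : R) f g, H1 f -> H1 g ->
  L2eq P (B (fun x => a * f x + g x)) (fun x => a * B f x + B g x).
Variable C : R.
Hypothesis B_bound : forall f, H1 f -> L2norm P (B f) <= C * Num.sqrt (fc f f).
Variable lambda : R.
Hypothesis lambda_gt0 : 0 < lambda.

Local Notation K := (ker_in P H1 B).
Local Notation ql := (fun f h => fc f h + lambda * ip f h).

Lemma H1_V f : H1 f -> V f. Proof. by move=> /sobolev1P[]. Qed.

Lemma H1_L2 f : H1 f -> L2 P f. Proof. by move=> /H1_V[]. Qed.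

Lemma B_L2 f : H1 f -> L2 P (B f). Proof. by move=> /BH[]. Qed.

Lemma H1_subspace : is_subspace H1.
Proof.
split=> [|a f g /sobolev1P[Vf f0] /sobolev1P[Vg g0]]; apply/sobolev1P.
  by split; [case: sV|rewrite (q0l ipI)].
split; first exact: sV.2.
have Lf : L2 P f by case: Vf.
have Lg : L2 P g by case: Vg.
by rewrite (si_lin ipI)// f0 g0 mulr0 addr0.
Qed.

Lemma ql_semi_inner : semi_inner H1 ql.
Proof.
split; first exact: H1_subspace.
- move=> f g Hf Hg; rewrite (si_sym fcI (H1_V Hf) (H1_V Hg)).
  by rewrite (si_sym ipI (H1_L2 Hf) (H1_L2 Hg)).
- move=> a f g h Hf Hg Hh.
  rewrite (si_lin fcI a (H1_V Hf) (H1_V Hg) (H1_V Hh)).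
  by rewrite (si_lin ipI a (H1_L2 Hf) (H1_L2 Hg) (H1_L2 Hh)); ring.
- move=> f Hf; rewrite addr_ge0//; first exact/(si_ge0 fcI)/H1_V.
  by rewrite mulr_ge0 ?(ltW lambda_gt0)//; exact/(si_ge0 ipI)/H1_L2.
Qed.

Lemma form_le_ql f : H1 f -> fc f f <= ql f f.
Proof.
move=> Hf; rewrite lerDl mulr_ge0 ?(ltW lambda_gt0)//.
exact/(si_ge0 ipI)/H1_L2.
Qed.

Lemma ip_le_ql f : H1 f -> ip f f <= ql f f / lambda.
Proof.
move=> Hf; rewrite ler_pdivlMr// mulrC lerDr.
exact/(si_ge0 fcI)/H1_V.
Qed.

Lemma B_bound_sqr f : H1 f -> ip (B f) (B f) <= C ^+ 2 * fc f f.
Proof.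
move=> Hf; have f0 := si_ge0 fcI (H1_V Hf).
have b0 := si_ge0 ipI (B_L2 Hf).
have s0 : 0 <= L2norm P (B f) by exact: sqrtr_ge0.
have := B_bound Hf; rewrite -(ler_pXn2r (_ : 0 < 2)%N) ?nnegrE//; last first.
  exact: le_trans (B_bound Hf).
by rewrite /L2norm sqr_sqrtr// exprMn sqr_sqrtr.
Qed.

Lemma B_sub f g : H1 f -> H1 g -> K g -> L2eq P (B f) (B (f - g)).
Proof.
move=> Hf Hg [_ Bg0]; have e := B_lin (-1) Hg Hf.
have -> : f - g = (fun x => -1 * g x + f x).
  by apply/funext => x; rewrite mulN1r addrC.
apply: L2eq_sym; apply: (L2eq_trans e).
by apply: filterS Bg0 => x ->; rewrite mulr0 add0r.
Qed.

Lemma ker_subspace : is_subspace K.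
Proof.
split.
  split; first by case: H1_subspace.
  have H0 : H1 0 by case: H1_subspace.
  have := B_lin (-1) H0 H0.
  have -> : (fun x : T => -1 * (0 : T -> R) x + (0 : T -> R) x) = 0.
    by apply/funext => x; rewrite mulr0 addr0.
  by move=> /L2eq_trans; apply; apply: nearW => x /=; rewrite mulN1r addNr.
move=> a f g [Hf Bf] [Hg Bg]; split; first exact: H1_subspace.2.
apply: (L2eq_trans (B_lin a Hf Hg)).
apply: (L2eq_trans (L2eq_lin a Bf Bg)).
by apply: nearW => x /=; rewrite mulr0 addr0.
Qed.

(** The range is closed under almost everywhere equality by definition, so the kernel must be too.
    Nothing says directly that [B] respects this equality: it follows from boundedness, because
    [g - f] has zero energy. *)
Lemma ker_saturated f g : K f -> L2 P g -> L2eq P f g -> K g.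
Proof.
move=> Kf Lg fg; have [Hf _] := Kf; have [Vf f0] := (sobolev1P f).1 Hf.
have Lf := H1_L2 Hf.
have fg0 : ip (f - g) (f - g) = 0 by exact/L2eqP.
(* The constant sequence [f] converges to [g] in L^2, so closedness of the form gives both [V g] and
   convergence in energy. *)
have c1 : qcvg ip (fun=> f) g by move=> e e0; exists 0%N => n _; rewrite fg0.
have c2 := qcvg_cauchy fcI (fun=> Vf) Vf (qcvg_cst fcI Vf).
have [Vg c3] := form_closure_closed DL2 SL2 qD qS (fun=> Vf) Lg c1 c2.
have Hg : H1 g by apply/sobolev1P; split => //; rewrite -(L2eq_ip Lf Lg (Lphi 0) fg).
split => //.
have Hgf := is_subspaceB H1_subspace Hg Hf.
have fc0 : fc (g - f) (g - f) = 0.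
  apply: small_eq0; first exact/(si_ge0 fcI)/H1_V.
  move=> e /c3[N /(_ N (leqnn N))]; by rewrite (qsub_sym fcI Vf Vg).
apply: (L2eq_trans (B_sub Hg Hf Kf)); apply/L2ip_eq0; first exact: B_L2.
apply/eqP; rewrite eq_le (si_ge0 ipI (B_L2 Hgf)) andbT.
by have := B_bound_sqr Hgf; rewrite fc0 mulr0.
Qed.

(** A Cauchy sequence for the sum of the two forms is Cauchy for each. Completeness of L^2 supplies
    the limit, closedness of the energy form puts it in H^1, and boundedness of [B] puts it in the
    kernel. *)
Lemma ker_complete u : (forall n, K (u n)) -> qcauchy ql u ->
  exists2 f, K f & qcvg ql u f.
Proof.
move=> Ku cu.
have Hu n : H1 (u n) by case: (Ku n).
have Lu n := H1_L2 (Hu n).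
have Vu n := H1_V (Hu n).
have Hd m n := is_subspaceB H1_subspace (Hu m) (Hu n).
have cip : qcauchy ip u.
  move=> e e0; have [N NP] := cu _ (mulr_gt0 e0 lambda_gt0).
  exists N => m n Nm Nn; apply: (le_lt_trans (ip_le_ql (Hd m n))).
  by rewrite ltr_pdivrMr//; exact: NP.
have cfc : qcauchy fc u.
  move=> e e0; have [N NP] := cu _ e0.
  exists N => m n Nm Nn; apply: (le_lt_trans (form_le_ql (Hd m n))).
  exact: NP.
have [f Lf uf] := L2_complete Lu cip.
have [Vf fuf] := form_closure_closed DL2 SL2 qD qS Vu Lf uf cfc.
have f0 : ip f (phi 0%N) = 0.
  have h1 := q_pair_cvg ipI Lu (fun=> Lphi 0) Lf (Lphi 0) uf (qcvg_cst ipI (Lphi 0)).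
  apply: (real_cvg_unique h1); apply: (@eq_cvg_to _ _ (fun=> 0)) => [n|]; last exact: cvg_cst.
  by have /sobolev1P[] := Hu n.
have Hf : H1 f by apply/sobolev1P.
exists f.
  split => //; apply/L2ip_eq0; first exact: B_L2.
  apply: small_eq0; first exact/(si_ge0 ipI)/B_L2.
  move=> e e0.
  (* The [+ 1] avoids a division by zero when [C = 0]. Since [B (u N)] vanishes, [B f] agrees with
     [B (f - u N)], whose squared norm is at most [C ^+ 2] times the energy of [f - u N]. *)
  have C0 : 0 < C ^+ 2 + 1 by rewrite ltr_wpDl// sqr_ge0.
  have [N /(_ N (leqnn N)) NP] := fuf _ (divr_gt0 e0 C0).
  have Hfu := is_subspaceB H1_subspace Hf (Hu N).
  have e1 := B_sub Hf (Hu N) (Ku N).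
  have LBf := B_L2 Hf; have LBd := B_L2 Hfu.
  rewrite (L2eq_ip LBf LBd LBf e1) (si_sym ipI LBd LBf) (L2eq_ip LBf LBd LBd e1).
  apply: (le_lt_trans (B_bound_sqr Hfu)).
  rewrite (qsub_sym fcI Vf (Vu N)).
  have g0 := si_ge0 fcI (is_subspaceB sV (Vu N) Vf).
  apply: (@le_lt_trans _ _ ((C ^+ 2 + 1) * fc (u N - f) (u N - f))).
    by rewrite ler_wpM2r// lerDl.
  by rewrite mulrC -ltr_pdivlMr.
move=> e e0; have e2 : 0 < e / 2 by rewrite divr_gt0.
have [N1 h1] := fuf _ e2.
have [N2 h2] := uf _ (divr_gt0 e2 lambda_gt0).
exists (maxn N1 N2) => n; rewrite geq_max => /andP[n1 n2].
rewrite [ltRHS]splitr ltrD ?h1//.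
by rewrite mulrC -ltr_pdivlMr//; exact: h2.
Qed.

Lemma range_sub_ker :
  range_on P H (neg_proj_resolvent P A lambda H1 K ql) `<=` K.
Proof.
move=> u [Lu [g Hg [w [p [_ [_ Kp _] up]]]]].
apply: (ker_saturated (is_subspaceN ker_subspace Kp) Lu).
exact: L2eq_sym.
Qed.

(** Each [phi k] is an eigenvector of [A - lambda] for [- (ev k + lambda)], which dictates the
    coefficients of the right-hand side. *)
Lemma psum_resolvent a n :
  A (psum1 a phi n) (fun x => lambda * psum1 a phi n x +
    psum1 (fun k => - a k * (ev k + lambda)) phi n x).
Proof.
have -> : (fun x => lambda * psum1 a phi n x +
    psum1 (fun k => - a k * (ev k + lambda)) phi n x) =
    psum1 (fun k => - a k * ev k) phi n.
  apply/funext => x; rewrite /psum1 mulr_sumr -big_split/=.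
  by apply: eq_bigr => k _; ring.
rewrite !psum1E; apply/friedrichsP; split; [exact: esum_onL2|exact: esum_onL2| |].
  exact: esum_onV.
move=> h Dh; rewrite !esum_on_ip//; [|exact: DL2|exact: SL2].
apply: eq_bigr => k _; have /friedrichsP[_ _ _ ->//] := phi_eigen Asp k.
by rewrite (qZl ipI (- ev k) (Lphi k) (DL2 Dh)); ring.
Qed.

Lemma range_dense_in_ker k (e : R) : K k -> 0 < e ->
  exists2 s, range_on P H (neg_proj_resolvent P A lambda H1 K ql) s &
    ip (k - s) (k - s) < e.
Proof.
move=> Kk e0; have KN := is_subspaceN ker_subspace Kk.
have [HN _] := KN; have [LN [a [ca aN]]] := HN.
have [VN _ c1 c2] := sobolev1_expansion LN ca aN.
(* The target is [ql < e * lambda], half for the energy and half for [lambda] times the L^2 part;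
   dividing by [lambda] then returns [e]. *)
have el : 0 < e * lambda / 2 by rewrite divr_gt0// mulr_gt0.
have [N1 h1] := c1 _ el.
have [N2 h2] := c2 _ (divr_gt0 e0 (ltr0n _ 2 : 0 < 2%:R)).
pose n := maxn N1 N2; pose w := psum1 a phi n.
have {}h1 := h1 n (leq_maxl _ _); have {}h2 := h2 n (leq_maxr _ _).
rewrite -/w in h1 h2.
have Hw : H1 w by exact: sobolev_psum.
have [p Kp wp] := orthogonal_projection ql_semi_inner ker_subspace
  (fun f Kf => proj1 Kf) ker_complete Hw.
have [Hp _] := Kp.
have Kd := is_subspaceB ker_subspace Kp KN.
have [Hd _] := Kd.
exists (- p).
  split; first exact/(is_subspaceN sL2)/H1_L2.
  exists (psum1 (fun k => - a k * (ev k + lambda)) phi n); first exact: sobolev_psum.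
  by exists w, p; split; [exact: psum_resolvent|split|exact: nearW].
have -> : k - - p = p - - k by rewrite !opprK addrC.
apply: (le_lt_trans (ip_le_ql Hd)).
rewrite ltr_pdivrMr//.
have Hwp := is_subspaceB H1_subspace Hw Hp.
(* [w - p] is orthogonal to [p - (- k)], which lies in the kernel, so by Pythagoras [p] is at least
   as close to [- k] as [w] is. *)
have pyth := q_orthogonal_le ql_semi_inner Hwp Hd (wp _ Kd).
rewrite subrKA in pyth; apply: (le_lt_trans pyth).
rewrite (_ : e * lambda = e * lambda / 2 + lambda * (e / 2)); last by field.
by rewrite ltrD// ltr_pM2l.
Qed.

Theorem closure_range_ker :
  closure_in P H (range_on P H (neg_proj_resolvent P A lambda H1 K ql)) =
  closure_in P H K.
Proof.
apply/seteqP; split=> [f [Hf fR]|f [Hf fK]]; split => // e e0.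
  by have [s /range_sub_ker Ks fs] := fR _ e0; exists s.
(* Squared distances satisfy the triangle inequality with a factor 2, so two of size [e ^+ 2 / 4]
   combine to [e ^+ 2]. *)
have e2 : 0 < e ^+ 2 / 4 by rewrite divr_gt0// exprn_gt0.
have s2 : 0 < Num.sqrt (e ^+ 2 / 4) by rewrite sqrtr_gt0.
have [k Kk fk] := fK _ s2.
have [s Rs ks] := range_dense_in_ker Kk e2.
have Lf : L2 P f by case: Hf.
have Lk : L2 P k by case: Kk => /H1_L2.
have Ls : L2 P s by case: Rs.
exists s => //.
rewrite L2norm_lt// in fk; last exact: is_subspaceB sL2 Lf Lk.
rewrite sqr_sqrtr ?(ltW e2)// in fk.
rewrite L2norm_lt//; last exact: is_subspaceB sL2 Lf Ls.
exact: (ltr_quarters (q_trans ipI Lf Lk Ls) fk ks).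
Qed.

End Projection.

End Spectral.

(** * The product rule for the generator *)

Section DirectionalDerivatives.
Context {R : realType} {W : normedModType R}.
Implicit Types (x v : W).

Lemma derivable_bigsum (I : Type) (r : seq I) (F : I -> W -> R) x v :
  (forall i, derivable (F i) x v) ->
  derivable (fun y => \sum_(i <- r) F i y) x v.
Proof.
move=> dF; elim: r => [|i r IH].
  by under eq_fun do rewrite big_nil; exact: derivable_cst.
rewrite (_ : (fun y => _) = F i + (fun y => \sum_(j <- r) F j y)).
  exact: (derivableD (dF i) IH).
by apply/funext => y; rewrite big_cons.
Qed.

Lemma derivable_bigprod (I : Type) (r : seq I) (F : I -> W -> R) x v :
  (forall i, derivable (F i) x v) ->
  derivable (fun y => \prod_(i <- r) F i y) x v.
Proof.
move=> dF; elim: r => [|i r IH].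
  by under eq_fun do rewrite big_nil; exact: derivable_cst.
rewrite (_ : (fun y => _) = F i * (fun y => \prod_(j <- r) F j y)).
  exact: (derivableM (dF i) IH).
by apply/funext => y; rewrite big_cons.
Qed.

Lemma derivable_det n (M : W -> 'M[R]_n) x v :
  (forall i j, derivable (fun y => M y i j) x v) ->
  derivable (fun y => \det (M y)) x v.
Proof.
move=> dM; apply: derivable_bigsum => s.
apply: derivableM; first exact: derivable_cst.
by apply: derivable_bigprod => i; exact: dM.
Qed.

(** Along [v] the problem has one real variable, where derivability is differentiability and the
    chain rule applies; positivity keeps the square root away from 0. *)
Lemma derivable_sqrt (f : W -> R) x v : 0 < f x -> derivable f x v ->
  derivable (fun y => Num.sqrt (f y)) x v.
Proof.
move=> f0 /derivable1P df; apply/derivable1P/derivable1_diffP.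
apply: (@differentiable_comp _ _ _ _ (fun h : R => f (h *: v + x)) Num.sqrt).
  exact/derivable1_diffP.
by apply/derivable1_diffP; rewrite scale0r add0r; case: (is_derive1_sqrt f0).
Qed.

Lemma deriveMD (a b f h : W -> R) x v : derivable a x v -> derivable b x v ->
  derivable f x v -> derivable h x v ->
  'D_v (a * f + b * h) x =
  a x * 'D_v f x + b x * 'D_v h x + 'D_v a x * f x + 'D_v b x * h x.
Proof.
move=> da db df dh.
rewrite (deriveD (derivableM da df) (derivableM db dh)).
rewrite (deriveM da df) (deriveM db dh) /GRing.scale/=.
by move: ('D_v a x) ('D_v b x) ('D_v f x) ('D_v h x) => ? ? ? ?; ring.
Qed.

End DirectionalDerivatives.

(* The determinant of [t G + (1 - t) I] does not vanish on [0, 1]. *)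
Lemma posdef_det_gt0 (R : rcfType) n (G : 'M[R]_n) :
  (forall v : 'rV[R]_n, v != 0 -> 0 < (v *m G *m v^T) ord0 ord0) ->
  0 < \det G.
Proof.
move=> Gpos; rewrite ltNge; apply/negP => G0.
pose M : 'M[{poly R}]_n := \matrix_(i, j) ('X * (G i j)%:P + (1 - 'X) * (i == j)%:R%:P).
(* The sign makes [p] go from -1 at 0 to [- \det G], assumed nonnegative, at 1. A root [t] yields a
   nonzero [v] with [t vGv^T + (1 - t) vv^T = 0], which is impossible. *)
pose p := - \det M.
have pE t : p.[t] = - \det (t *: G + (1 - t)%:M).
  rewrite hornerN; congr (- _); rewrite -[LHS]/(horner_eval t _) -det_map_mx.
  congr (\det _); apply/matrixP => i j; rewrite !mxE /horner_eval.
  rewrite -[LHS]/(('X * (G i j)%:P + (1 - 'X) * (i == j)%:R%:P).[t]).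
  by rewrite !hornerE mulr_natr; case: (i == j); rewrite ?mulr1n ?mulr0n.
have p01 : p.[0] <= 0 <= p.[1].
  rewrite !pE scale0r add0r subr0 det1 scale1r subrr raddf0 addr0 oppr_ge0 G0.
  by rewrite oppr_le0 ler01.
have [t /andP[t0 t1]] := poly_ivt (@ler01 R) p01.
rewrite rootE pE oppr_eq0 => /det0P[v v0 /(congr1 (fun u => (u *m v^T) ord0 ord0))].
have vv0 : 0 < (v *m v^T) ord0 ord0.
  rewrite mxE; under eq_bigr do rewrite mxE -expr2.
  rewrite lt_def sumr_ge0 ?andbT; last by move=> i _; rewrite sqr_ge0.
  apply: contra v0; rewrite psumr_eq0; last by move=> i _; rewrite sqr_ge0.
  move=> /allP v0; apply/eqP/rowP => i; rewrite mxE; apply/eqP.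
  by have := v0 i (mem_index_enum i); rewrite /= sqrf_eq0.
rewrite mul0mx mulmxDr mulmxDl -scalemxAr mul_mx_scalar -!scalemxAl.
rewrite mxE [X in X + _]mxE [X in _ + X]mxE [RHS]mxE.
have [->|t_neq0] := eqVneq t 0.
  by rewrite mul0r add0r subr0 mul1r => /eqP; rewrite gt_eqF.
apply/eqP; rewrite gt_eqF// ltr_pwDl//.
  by rewrite mulr_gt0 ?Gpos// lt_def t_neq0.
by rewrite mulr_ge0 ?subr_ge0// ltW.
Qed.

(** * Stability of [Ck] under algebraic operations *)

Section CkTheory.
Context {R : realType} {d : nat}.
Implicit Types (O : set 'rV[R]_d) (F G : 'rV[R]_d -> R).

Lemma partial_eq i O F G : open O -> (forall x, O x -> F x = G x) ->
  forall x, O x -> partial i F x = partial i G x.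
Proof.
move=> oO FG x Ox; apply: near_eq_derive.
by apply: filterS (open_nbhs_nbhs (conj oO Ox)) => y; exact: FG.
Qed.

(** The rules for partial derivatives of sums and products hold on [O] only; openness of [O] lets
    [Ck] pass between functions that agree there. *)
Lemma Ck_eq k O F G : open O -> (forall x, O x -> F x = G x) ->
  Ck k O F -> Ck k O G.
Proof.
move=> oO; elim: k F G => [|k IH] F G FG [cF dF];
  (have FGx x : O x -> {near x, F =1 G} by
    move=> Ox; apply: filterS (open_nbhs_nbhs (conj oO Ox)) => y; exact: FG);
  (have cG x : O x -> {for x, continuous G} by
    move=> Ox; rewrite /prop_for /continuous_at -(FG x Ox);
    exact: cvg_trans (@near_eq_cvg _ _ (nbhs x) _ F G (FGx _ Ox)) (cF x Ox)).
- by [].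
- split => // i.
  have [dFi CF] := dF i; split => [x Ox|].
    exact: near_eq_derivable (FGx _ Ox) (dFi _ Ox).
  by apply: IH CF; exact: partial_eq.
Qed.

Lemma Ck_S k O F : Ck k.+1 O F -> Ck k O F.
Proof.
elim: k F => [|k IH] F [cF dF]; first by split.
split => // i; have [dFi CF] := dF i; split => //.
exact: IH.
Qed.

Lemma Ck_cst k O c : Ck k O (cst c).
Proof.
elim: k c => [|k IH] c; first by split => // x _; exact: cst_continuous.
split => [x _|i]; first exact: cst_continuous.
split => [x _|]; first exact: derivable_cst.
rewrite (_ : partial i (cst c) = cst 0); first exact: IH.
by apply/funext => x; exact: derive_cst.
Qed.

Lemma CkD k O F G : open O -> Ck k O F -> Ck k O G -> Ck k O (F + G).
Proof.
move=> oO; elim: k F G => [|k IH] F G [cF dF] [cG dG].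
  by split => // x Ox; apply: continuousD; [exact: cF|exact: cG].
split => [x Ox|i]; first by apply: continuousD; [exact: cF|exact: cG].
have [dFi CF] := dF i; have [dGi CG] := dG i; split => [x Ox|].
  by apply: derivableD; [exact: dFi|exact: dGi].
apply: Ck_eq (IH _ _ CF CG) => // x Ox.
by rewrite [RHS]deriveD//; [exact: dFi|exact: dGi].
Qed.

Lemma CkM k O F G : open O -> Ck k O F -> Ck k O G -> Ck k O (F * G).
Proof.
move=> oO; elim: k F G => [|k IH] F G.
  by move=> [cF dF] [cG dG]; split => // x Ox; apply: continuousM; [exact: cF|exact: cG].
move=> CF CG; have CF' := Ck_S CF; have CG' := Ck_S CG.
have [cF dF] := CF; have [cG dG] := CG.
split => [x Ox|i]; first by apply: continuousM; [exact: cF|exact: cG].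
have [dFi CFi] := dF i; have [dGi CGi] := dG i; split => [x Ox|].
  by apply: derivableM; [exact: dFi|exact: dGi].
apply: Ck_eq (CkD oO (IH _ _ CF' CGi) (IH _ _ CG' CFi)) => // x Ox.
by rewrite [RHS]deriveM//; [exact: dFi|exact: dGi].
Qed.

End CkTheory.

(** * The Laplace-Beltrami operator and its product rule in one chart *)

Section Coordinates.
Context {R : realType} {d : nat} {M : ptopologicalType}.
Variables (X : oriented_manifold R d M) (g : riemannian_metric X).
Variables (c : chart R d M) (Xc : atlas X c).
Local Notation O := (cimg c).
Local Notation e_ k := (delta_mx ord0 k : 'rV[R]_d).
Implicit Types (F H : 'rV[R]_d -> R) (x y : 'rV[R]_d).

Let oO : open O. Proof. exact: cimg_open. Qed.

Lemma gmat_det_gt0 y : O y -> 0 < \det (gmat g c y).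
Proof. by move=> Oy; apply: posdef_det_gt0 => v; exact: gmat_pos. Qed.

Lemma gmat_unit y : O y -> gmat g c y \in unitmx.
Proof. by move=> Oy; rewrite unitmxE unitfE gt_eqF// gmat_det_gt0. Qed.

Lemma invmx_gmat_sym y : O y -> (invmx (gmat g c y))^T = invmx (gmat g c y).
Proof. by move=> Oy; rewrite trmx_inv gmat_sym. Qed.

Lemma gmat_derivable i j y k : O y ->
  derivable (fun z => gmat g c z i j) y (e_ k).
Proof.
move=> Oy; have [_ /(_ k)[dG _]] := gmat_smooth g Xc i j 1.
exact: dG.
Qed.

Lemma vol_density_gt0 y : O y -> 0 < vol_density g c y.
Proof. by move=> Oy; rewrite sqrtr_gt0 gmat_det_gt0. Qed.

(** The coefficient sqrt(det g) g^{ki} of the Laplace-Beltrami operator in divergence form. *)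
Definition flux_weight k i y := vol_density g c y * invmx (gmat g c y) k i.

Lemma flux_weight_derivable k i y l : O y -> derivable (flux_weight k i) y (e_ l).
Proof.
move=> Oy.
have dG a b : derivable (fun z => gmat g c z a b) y (e_ l).
  exact: gmat_derivable Oy.
have ddet := @derivable_det R 'rV[R]_d d (gmat g c) y (e_ l) dG.
have dvol := @derivable_sqrt R 'rV[R]_d (fun z => \det (gmat g c z)) y (e_ l) (gmat_det_gt0 Oy) ddet.
have dinv := @derivableV R 'rV[R]_d (fun z => \det (gmat g c z)) y (e_ l) (lt0r_neq0 (gmat_det_gt0 Oy)) ddet.
have dG' a b : derivable (fun z => (row' i (col' k (gmat g c z))) a b) y (e_ l).
  rewrite (_ : (fun z => _) = (fun z => gmat g c z (lift i a) (lift k b))).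
    exact: dG.
  by apply/funext => z; rewrite !mxE.
have dcof := derivableM (derivable_cst ((-1) ^+ (i + k) : R) y (e_ l))
  (@derivable_det R 'rV[R]_d _ (fun z => row' i (col' k (gmat g c z))) y (e_ l) dG').
(* [invmx] is given by cofactors only where the matrix is invertible, which holds on the whole chart
   image, a neighbourhood of [y]. *)
apply: near_eq_derivable (derivableM dvol (derivableM dinv dcof)).
apply: filterS (open_nbhs_nbhs (conj oO Oy)) => z Oz.
by rewrite /flux_weight /invmx gmat_unit// !mxE.
Qed.

Definition drow F y : 'rV[R]_d := \row_k partial k F y.

Definition flux F i y : R :=
  vol_density g c y * (drow F y *m invmx (gmat g c y)) ord0 i.

Definition coord_laplacian F y :=
  (vol_density g c y)^-1 * \sum_(i < d) partial i (flux F i) y.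

(** The carre du champ: the product of the differentials for the inverse metric. *)
Definition coord_gamma F H y : R :=
  (drow F y *m invmx (gmat g c y) *m (drow H y)^T) ord0 ord0.

(** Derivability along coordinate directions, up to order two, is the regularity on which the
    product rules below rely. *)
Definition C2_on F := (forall k y, O y -> derivable F y (e_ k)) /\
  (forall k l y, O y -> derivable (partial k F) y (e_ l)).

Lemma fluxE F i y : flux F i y = \sum_k partial k F y * flux_weight k i y.
Proof.
rewrite /flux mxE mulr_sumr; apply: eq_bigr => k _.
by rewrite mxE mulrCA.
Qed.

Lemma flux_derivable F i l y : C2_on F -> O y -> derivable (flux F i) y (e_ l).
Proof.
move=> [_ dF] Oy.
rewrite (_ : flux F i = fun z => \sum_k partial k F z * flux_weight k i z).
  apply: derivable_bigsum => k.
  have := derivableM (dF k l y Oy) (@flux_weight_derivable k i y l Oy).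
  exact.
by apply/funext => z; exact: fluxE.
Qed.

Lemma drowM F H y : C2_on F -> C2_on H -> O y ->
  drow (F * H) y = F y *: drow H y + H y *: drow F y.
Proof.
move=> [dF _] [dH _] Oy; apply/rowP => k; rewrite !mxE.
by rewrite [LHS]deriveM//; [exact: dF|exact: dH].
Qed.

Lemma coord_gammaC F H y : O y -> coord_gamma F H y = coord_gamma H F y.
Proof.
move=> Oy; rewrite /coord_gamma -[in LHS](trmxK (_ *m _ *m _)) [LHS]mxE.
by rewrite !trmx_mul trmxK invmx_gmat_sym// mulmxA.
Qed.

Lemma coord_gammaMr U F H y : C2_on F -> C2_on H -> O y ->
  coord_gamma U (F * H) y = F y * coord_gamma U H y + H y * coord_gamma U F y.
Proof.
move=> CF CH Oy; rewrite /coord_gamma (drowM CF CH Oy).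
rewrite [X in _ *m X]linearD [X in _ *m (X + _)]linearZ [X in _ *m (_ + X)]linearZ.
by rewrite mulmxDr -!scalemxAr mxE [X in X + _]mxE [X in _ + X]mxE.
Qed.

Lemma fluxM F H i y : C2_on F -> C2_on H -> O y ->
  flux (F * H) i y = F y * flux H i y + H y * flux F i y.
Proof.
move=> CF CH Oy; rewrite /flux drowM// mulmxDl -!scalemxAl mxE.
by rewrite [X in X + _]mxE [X in _ + X]mxE; ring.
Qed.

Lemma sum_flux F H y :
  \sum_i partial i F y * flux H i y = vol_density g c y * coord_gamma H F y.
Proof.
rewrite /coord_gamma [in RHS]mxE mulr_sumr; apply: eq_bigr => i _.
have -> : (drow F y)^T i ord0 = partial i F y by rewrite !mxE.
by rewrite mulrC mulrA.
Qed.

(** Differentiating the flux of the product leaves two cross sums, of partials of one factor against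
    the flux of the other; symmetry of the inverse metric identifies them, whence the factor 2. *)
Lemma coord_laplacianM F H y : C2_on F -> C2_on H -> O y ->
  coord_laplacian (F * H) y = F y * coord_laplacian H y +
    H y * coord_laplacian F y + 2 * coord_gamma F H y.
Proof.
move=> CF CH Oy.
have e i : partial i (flux (F * H) i) y =
    F y * partial i (flux H i) y + H y * partial i (flux F i) y +
    partial i F y * flux H i y + partial i H y * flux F i y.
  rewrite (partial_eq (F := flux (F * H) i) (G := F * flux H i + H * flux F i) i oO _ Oy).
    have dF := CF.1 i y Oy; have dH := CH.1 i y Oy.
    have dfF := @flux_derivable F i i y CF Oy; have dfH := @flux_derivable H i i y CH Oy.
    exact: (deriveMD dF dH dfH dfF).
  by move=> z Oz; rewrite fluxM.
have sumE : \sum_i partial i (flux (F * H) i) y =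
    F y * \sum_i partial i (flux H i) y + H y * \sum_i partial i (flux F i) y +
    vol_density g c y * coord_gamma H F y + vol_density g c y * coord_gamma F H y.
  rewrite -!sum_flux !mulr_sumr -!big_split.
  by apply: eq_bigr => i _; exact: e.
rewrite (coord_gammaC H F Oy) in sumE.
rewrite /coord_laplacian; apply: (etrans (congr1 ( *%R _) sumE)).
have alg (v s t m a b : R) : 0 < v ->
    v^-1 * (a * s + b * t + v * m + v * m) = a * (v^-1 * s) + b * (v^-1 * t) + 2 * m.
  by move=> v0; field; rewrite gt_eqF.
exact: alg (vol_density_gt0 Oy).
Qed.

Lemma flux_cst a i y : flux (cst a) i y = 0.
Proof.
rewrite fluxE big1// => k _.
by rewrite /partial derive_cst mul0r.
Qed.

Lemma coord_laplacian_cst a y : coord_laplacian (cst a) y = 0.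
Proof.
rewrite /coord_laplacian big1 ?mulr0// => i _.
have -> : flux (cst a) i = cst 0 by apply/funext => z; exact: flux_cst.
exact: derive_cst.
Qed.

End Coordinates.

(** * The generator on functions of the manifold *)

Section Generator.
Context {R : realType} {d : nat} {M : ptopologicalType}.
Variables (X : oriented_manifold R d M) (g : riemannian_metric X).
Implicit Types (f h U : M -> R) (p : M).

Lemma smooth_cst a : smooth_fun X (cst a).
Proof. by move=> k c _; exact: Ck_cst. Qed.

Lemma smoothM f h : smooth_fun X f -> smooth_fun X h -> smooth_fun X (f * h).
Proof.
move=> sf sh k c Xc.
have CfM := CkM (@cimg_open _ _ _ c) (sf k c Xc) (sh k c Xc).
rewrite (_ : (f * h) \o cinv c = (f \o cinv c) * (h \o cinv c)).
  exact: CfM.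
by apply/funext.
Qed.

Lemma smooth_subspace : is_subspace (smooth_fun X).
Proof.
split; first exact: smooth_cst.
move=> a f h sf sh k c Xc.
have CaF := CkM (@cimg_open _ _ _ c) (Ck_cst k (cimg c) a) (sf k c Xc).
exact: (CkD (@cimg_open _ _ _ c) CaF (sh k c Xc)).
Qed.

Lemma smooth_C2 f c : atlas X c -> smooth_fun X f -> C2_on c (f \o cinv c).
Proof.
move=> Xc sf; have [_ Cf] := sf 2 c Xc; split=> [k|k l] y Oy.
  by have [df _] := Cf k; exact: df.
by have [_ [_ /(_ l)[df _]]] := Cf k; exact: df.
Qed.

Lemma chart_at_cimg p : cimg (chart_at X p) (cmap (chart_at X p) p).
Proof. by exists p => //; exact: chart_at_dom. Qed.

Lemma vdot_gradE f h p : vdot g (grad g f) (grad g h) p =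
  coord_gamma g (chart_at X p) (f \o cinv (chart_at X p))
    (h \o cinv (chart_at X p)) (cmap (chart_at X p) p).
Proof.
have Oy := chart_at_cimg p; have Xc := chart_at_atlas X p.
rewrite /vdot /grad /coord_gamma trmx_mul invmx_gmat_sym//.
by rewrite -!mulmxA (mulKVmx (gmat_unit g Xc Oy)).
Qed.

Lemma generatorE U f p : generator g U f p =
  coord_laplacian g (chart_at X p) (f \o cinv (chart_at X p))
    (cmap (chart_at X p) p) -
  coord_gamma g (chart_at X p) (U \o cinv (chart_at X p))
    (f \o cinv (chart_at X p)) (cmap (chart_at X p) p).
Proof. by rewrite -vdot_gradE. Qed.

(** The drift is a derivation, so the gradient term comes from the Laplacian alone. Each side is
    read in the chart [chart_at X p]. *)
Lemma generatorM U f h p : smooth_fun X f -> smooth_fun X h ->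
  generator g U (f * h) p = f p * generator g U h p + h p * generator g U f p +
    2 * vdot g (grad g f) (grad g h) p.
Proof.
move=> sf sh; rewrite !generatorE vdot_gradE.
have Xc := chart_at_atlas X p; have Oy := chart_at_cimg p.
set c := chart_at X p in Xc Oy *.
have pE : cinv c (cmap c p) = p by rewrite cmapK//; exact: chart_at_dom.
have CF := smooth_C2 Xc sf; have CH := smooth_C2 Xc sh.
rewrite -[(f * h) \o cinv c]/((f \o cinv c) * (h \o cinv c)).
rewrite (coord_laplacianM g Xc CF CH Oy) (coord_gammaMr g (U \o cinv c) CF CH Oy).
rewrite -[(f \o cinv c) (cmap c p)]/(f (cinv c (cmap c p))).
rewrite -[(h \o cinv c) (cmap c p)]/(h (cinv c (cmap c p))) pE.
have alg (a b s t m v w : R) : a * s + b * t + 2 * m - (a * v + b * w) =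
    a * (s - v) + b * (t - w) + 2 * m by ring.
exact: alg.
Qed.

Lemma generator_cst U a p : generator g U (cst a) p = 0.
Proof.
rewrite generatorE.
rewrite -[cst a \o _]/(cst a) coord_laplacian_cst sub0r /coord_gamma.
rewrite (_ : drow (cst a) _ = 0) ?trmx0 ?mulmx0 ?mxE ?oppr0//.
by apply/rowP => k; rewrite !mxE /partial derive_cst.
Qed.

Lemma vdot_grad_ge0 f p : 0 <= vdot g (grad g f) (grad g f) p.
Proof.
rewrite /vdot; set v := grad g f _ _; have [->|v0] := eqVneq v 0.
  by rewrite !mul0mx mxE.
by apply/ltW/gmat_pos => //; [exact: chart_at_atlas|exact: chart_at_cimg].
Qed.

End Generator.

(** * The Dirichlet form *)

Section DirichletForm.
Context {R : realType} {d : nat} {M : ptopologicalType}.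
Variables (X : oriented_manifold R d M) (g : riemannian_metric X).
Variables (U : M -> R) (pi : probability (@borel M) R).
Local Notation D := (smooth_fun X).
Local Notation S := (generator g U).
Hypotheses (DL2 : D `<=` L2 pi) (SL2 : forall f, D f -> L2 pi (S f)).
Hypothesis S_sym : forall f h, D f -> D h -> L2ip pi f (S h) = L2ip pi (S f) h.

Let ipI := @L2ip_semi_inner _ _ _ pi.

(** Symmetry tested against the constant 1, which is smooth and annihilated by the generator. *)
Lemma integral_generator f : D f -> (\int[pi]_x S f x = 0)%R.
Proof.
move=> Df; have D1 : D (cst 1) by exact: smooth_cst.
have := S_sym Df D1; rewrite {1}/L2ip => e.
transitivity (L2ip pi (S f) (cst 1)).
  by apply: eq_Rintegral => x _; rewrite /= mulr1.
rewrite -e; transitivity (\int[pi]_x (0 : R))%R.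
  by apply: eq_Rintegral => x _; rewrite generator_cst mulr0.
by rewrite Rintegral_cst// mul0r.
Qed.

Lemma dirichletE f h : D f -> D h -> dirichlet g pi f h = - L2ip pi f (S h).
Proof.
move=> Df Dh; have Dfh := smoothM Df Dh; have D1 : D (cst 1) by exact: smooth_cst.
(* [Rintegral] splits only over integrable terms. Here [S (f * h)] is integrable as the product of
   two L^2 functions, itself and the constant 1. *)
have i1 : pi.-integrable setT (EFin \o (S (f * h))).
  have := L2_integrableM (SL2 Dfh) (DL2 D1).
  by congr (pi.-integrable _ _); apply/funext => x /=; rewrite mulr1.
have i2 := L2_integrableM (DL2 Df) (SL2 Dh).
have i3 := L2_integrableM (DL2 Dh) (SL2 Df).
have i12 : pi.-integrable setT (EFin \o (fun x => S (f * h) x - f x * S h x)).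
  by have := integrableB measurableT i1 i2.
have i123 : pi.-integrable setT
    (EFin \o (fun x => S (f * h) x - f x * S h x - h x * S f x)).
  by have := integrableB measurableT i12 i3.
have -> : dirichlet g pi f h =
    (\int[pi]_x (2^-1 * (S (f * h) x - f x * S h x - h x * S f x)))%R.
  apply: eq_Rintegral => x _; rewrite generatorM//.
  have alg (a b c : R) : c = 2^-1 * (a + b + 2 * c - a - b) by field.
  exact: alg.
rewrite (RintegralZl _ measurableT i123) (RintegralB measurableT i12 i3).
rewrite (RintegralB measurableT i1 i2) integral_generator//.
have e3 : (\int[pi]_x (h x * S f x) = L2ip pi f (S h))%R.
  by rewrite S_sym// (si_sym ipI)//; [exact: SL2|exact: DL2].
have alg (a b : R) : b = a -> 2^-1 * (0 - a - b) = - a by move=> ->; field.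
exact: alg e3.
Qed.

Lemma dirichlet_semi_inner : semi_inner D (dirichlet g pi).
Proof.
split; first exact: smooth_subspace.
- move=> f h Df Dh; rewrite (dirichletE Df Dh) (dirichletE Dh Df).
  by rewrite (S_sym Df Dh) (si_sym ipI (SL2 Df) (DL2 Dh)).
- move=> a f h k Df Dh Dk.
  have Dafh := (@smooth_subspace _ _ _ X).2 a f h Df Dh.
  rewrite (dirichletE Dafh Dk) (dirichletE Df Dk) (dirichletE Dh Dk).
  by rewrite (si_lin ipI a (DL2 Df) (DL2 Dh) (SL2 Dk)) opprD mulrN.
- by move=> f _; apply: Rintegral_ge0 => x _; exact: vdot_grad_ge0.
Qed.

End DirichletForm.

Theorem proposition6 (R : realType) (d : nat) (M : ptopologicalType)
    (X : oriented_manifold R d M) (g : riemannian_metric X)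
    (Mcompact : compact [set: M])
    (vol : {measure set (@borel M) -> \bar R})
    (vol_riemannian : riemannian_volume g vol)
    (U : M -> R) (U_C1 : Ck_fun X 1 U)
    (pi : probability (@borel M) R) (pi_density : weighted_volume vol U pi)
    (A : @operator _ (@borel M) R)
    (A_friedrichs : friedrichs_extension pi (smooth_fun X) (generator g U) A)
    (ev : nat -> R) (phi : nat -> M -> R)
    (A_spectrum : discrete_spectrum pi A ev phi)
    (H1 : set (M -> R)) (H1E : H1 = sobolev pi ev phi 1)
    (H : set (M -> R)) (HE : H = sobolev pi ev phi 0)
    (b : @vfield R d M) (b_C1 : Ck_vfield X 1 b)
    (b_div : forall p : M,
      divergence g (vscale (fun q => expR (- U q)) b) p = 0)
    (b_dom : H1 `<=` closure_dom pi (smooth_fun X) (advection g b))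
    (B : (M -> R) -> M -> R)
    (B_ext : continuous_extension pi (smooth_fun X) (advection g b)
               H1 H (H1ip g pi) B) :
  forall lambda : R, 0 < lambda ->
    let KerB := ker_in pi H1 B in
    let Rstar :=
      neg_proj_resolvent pi A lambda H1 KerB (H1ip_lambda g pi lambda) in
    closure_in pi H (range_on pi H Rstar) = closure_in pi H KerB.
Proof.
move=> lambda lambda_gt0 /=.
(* Since [A] extends the generator, its description applied to [A f (S f)] yields at once that [f]
   and [S f] are in L^2 and, further down, that the generator is symmetric. *)
have DL2 : smooth_fun X `<=` L2 pi by move=> f /(A_friedrichs.1)/(A_friedrichs.2 _ _).1[].
have SL2 f : smooth_fun X f -> L2 pi (generator g U f).
  by move=> /(A_friedrichs.1)/(A_friedrichs.2 _ _).1[].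
have S_sym f h : smooth_fun X f -> smooth_fun X h ->
    L2ip pi f (generator g U h) = L2ip pi (generator g U f) h.
  by move=> /(A_friedrichs.1)/(A_friedrichs.2 _ _).1[_ _ _]; exact.
have [BH B_lin [C B_bound] _] := B_ext.
subst H1 H.
have closures_eq := closure_range_ker (T := @borel M) (P := pi) DL2 SL2 (dirichlet_semi_inner DL2 SL2 S_sym)
  (dirichletE DL2 SL2 S_sym) A_friedrichs A_spectrum BH B_lin B_bound lambda_gt0.
exact closures_eq.
Qed.
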